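(* Let $Alg\,\mathcal{L}$ be a non-trivial CSL-algebra on a Hilbert space $\mathbb{H}$ and let $L\in\mathcal{L}$ be non-trivial. Let $\delta:Alg\,\mathcal{L}\to Alg\,\mathcal{L}$ be a continuous linear map. Then $\delta$ satisfies \[ A,B\in Alg\,\mathcal{L},\quad AB+BA=P_L\ \Longrightarrow\ 2A\delta(B)+2B\delta(A)=\delta(P_L) \] if and only if $\delta(A)=\beta(A)+P_LA(I-P_L)\delta(I)$ for all $A\in Alg\,\mathcal{L}$, where $\beta:Alg\,\mathcal{L}\to Alg\,\mathcal{L}$ is a continuous linear map satisfying \[ \beta(A)=(I-P_L)\beta\big((I-P_L)A(I-P_L)\big)(I-P_L)\quad\text{for all }A\in Alg\,\mathcal{L}, \] for all $A,B\in Alg\,\mathcal{L}$, \[ (I-P_L)A(I-P_L)B(I-P_L)+(I-P_L)B(I-P_L)A(I-P_L)=0\ \Longrightarrow\ (I-P_L)A\beta(B)+(I-P_L)B\beta(A)=0, \] and \[ P_LA(I-P_L)\beta(B)=P_LA(I-P_L)B(I-P_L)\delta(I)\quad\text{for all }A,B\in Alg\,\mathcal{L}. \]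
   Context: All algebras and vector spaces are over $\mathbb{F}$, where $\mathbb{F}$ is either $\mathbb{R}$ or $\mathbb{C}$. $\mathcal{B}(\mathbb{H})$ is the algebra of bounded linear operators on $\mathbb{H}$, $I$ is the identity operator, and $P_L$ is the (orthogonal) projection of $\mathbb{H}$ onto the closed subspace $L$. A subspace lattice $\mathcal{L}$ on $\mathbb{H}$ is a collection of norm-closed subspaces of $\mathbb{H}$ that is closed under arbitrary intersections and arbitrary closed linear spans and contains $\{0\}$ and $\mathbb{H}$; it is non-trivial if $\mathcal{L}\neq\{\{0\},\mathbb{H}\}$, and $L\in\mathcal{L}$ is non-trivial if $L\neq\{0\},\mathbb{H}$. $Alg\,\mathcal{L}=\{T\in\mathcal{B}(\mathbb{H}) : T(L)\subseteq L \text{ for all } L\in\mathcal{L}\}$. $\mathcal{L}$ is a commutative subspace lattice (CSL) if the projections of $\mathbb{H}$ onto the members of $\mathcal{L}$ commute with each other; then $Alg\,\mathcal{L}$ is called a CSL-algebra, and it is called non-trivial if $\mathcal{L}$ is non-trivial. Continuity refers to the operator norm. *)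

(* Defs.v *)
From HB Require Import structures.
From mathcomp Require Import all_boot all_order all_algebra.
From mathcomp Require Import complex.
From mathcomp Require Import all_classical all_reals all_analysis.

Set Implicit Arguments.
Unset Strict Implicit.
Unset Printing Implicit Defensive.

Import Order.TTheory GRing.Theory Num.Theory.
Import numFieldNormedType.Exports.

Local Open Scope classical_set_scope.
Local Open Scope ring_scope.

Variant scalar_kind := real_scalars | complex_scalars.

Definition scalars (R : realType) (k : scalar_kind) : numFieldType :=
  match k with real_scalars => R | complex_scalars => complex R end.

Definition scalar_conj (R : realType) (k : scalar_kind) :
    scalars R k -> scalars R k :=
  match k with real_scalars => idfun | complex_scalars => @conjc R end.

Definition scalar_re (R : realType) (k : scalar_kind) : scalars R k -> R :=
  match k with real_scalars => idfun | complex_scalars => @complex.Re R end.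

Definition scalar_of_real (R : realType) (k : scalar_kind) :
    R -> scalars R k :=
  match k with real_scalars => idfun | complex_scalars => real_complex R end.

Section ScalarTheory.
Variables (R : realType) (k : scalar_kind).
Implicit Types (x : scalars R k) (r s : R).

Lemma scalar_of_realK r : scalar_re (scalar_of_real k r) = r.
Proof. by case: k. Qed.

Lemma scalar_reK x : 0 <= x -> scalar_of_real k (scalar_re x) = x.
Proof.
case: k x => //= x x0; rewrite complex.RRe_real//; exact: ger0_real.
Qed.

Lemma scalar_of_real_le r s :
  (scalar_of_real k r <= scalar_of_real k s) = (r <= s).
Proof. by case: k => //=; rewrite lecR. Qed.

Lemma scalar_of_realD r s :
  scalar_of_real k (r + s) = scalar_of_real k r + scalar_of_real k s.
Proof. by case: k => //=; rewrite raddfD. Qed.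

Lemma scalar_of_realM r s :
  scalar_of_real k (r * s) = scalar_of_real k r * scalar_of_real k s.
Proof. by case: k => //=; rewrite rmorphM. Qed.

Lemma scalar_of_real0 : scalar_of_real k 0 = 0 :> scalars R k.
Proof. by case: k. Qed.

End ScalarTheory.

Section BoundedOperators.
Variables (K : numFieldType) (H : normedModType K).

Definition bounded_linear (T : H -> H) :=
  linear T /\ exists C : K, forall x, `|T x| <= C * `|x|.

Definition bounded_linear_pred : {pred (H -> H)} :=
  [pred T | `[< bounded_linear T >]].

Lemma bounded_linear_submod : submod_closed bounded_linear_pred.
Proof.
split.
  apply/asboolP; split=> [a x y|]; first by change (0 = a *: 0 + 0 :> H); rewrite scaler0 addr0.
  by exists 0 => x; change (`|0 : H| <= 0 * `|x|); rewrite normr0 mul0r.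
move=> a S T /asboolP[linS [C SC]] /asboolP[linT [D TD]]; apply/asboolP.
split=> [b x y|].
  change (a *: S (b *: x + y) + T (b *: x + y) =
    b *: (a *: S x + T x) + (a *: S y + T y)).
  by rewrite linS linT !scalerDr !scalerA (mulrC a) addrACA.
exists (`|a| * C + D) => x; change (`|a *: S x + T x| <= (`|a| * C + D) * `|x|).
rewrite (le_trans (ler_normD _ _))// mulrDl.
by rewrite lerD// normrZ -mulrA ler_wpM2l.
Qed.

HB.instance Definition _ :=
  GRing.isSubmodClosed.Build K (H -> H) bounded_linear_pred
    bounded_linear_submod.

Record bounded_operator := BoundedOperator {
  bounded_operator_fun :> H -> H;
  bounded_operatorP : bounded_operator_fun \in bounded_linear_pred
}.

HB.instance Definition _ := [isSub for bounded_operator_fun].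
HB.instance Definition _ := [Choice of bounded_operator by <:].
HB.instance Definition _ :=
  [SubChoice_isSubLmodule of bounded_operator by <:].

Implicit Types S T U : bounded_operator.

Lemma bounded_operator_ext S T : S =1 T -> S = T.
Proof. by move=> ST; apply/val_inj/funext. Qed.

Lemma bounded_operator_linear T : linear T.
Proof. by have /asboolP[] := bounded_operatorP T. Qed.

Lemma bounded_operator_bounded T : exists C : K, forall x, `|T x| <= C * `|x|.
Proof. by have /asboolP[] := bounded_operatorP T. Qed.

HB.instance Definition _ T :=
  GRing.isLinear.Build K H H _ T (bounded_operator_linear T).

Lemma bounded_linear_id : (idfun : H -> H) \in bounded_linear_pred.
Proof.
by apply/asboolP; split=> //; exists 1 => x; rewrite mul1r.
Qed.

Lemma bounded_linear_comp S T : (S \o T : H -> H) \in bounded_linear_pred.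
Proof.
apply/asboolP; split=> [a x y|]; first by rewrite /= !linearP.
have [C SC] := bounded_operator_bounded S.
have [D TD] := bounded_operator_bounded T.
exists (`|C| * D) => x /=.
rewrite (le_trans (SC _))// -mulrA (@le_trans _ _ (`|C| * `|T x|))//.
  have [->|Tx0] := eqVneq `|T x| 0; first by rewrite !mulr0.
  rewrite ler_wpM2r// real_ler_norm// realE; apply/orP; left.
  have Tx_gt0 : 0 < `|T x| by rewrite lt_def Tx0 normr_ge0.
  have := le_trans (normr_ge0 _) (SC (T x)).
  by rewrite pmulr_lge0.
by rewrite ler_wpM2l.
Qed.

Definition bounded_operator_one := BoundedOperator bounded_linear_id.
Definition bounded_operator_mul S T := BoundedOperator (bounded_linear_comp S T).

Lemma bounded_operator_mulA : associative bounded_operator_mul.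
Proof. by move=> S T U; exact: bounded_operator_ext. Qed.

Lemma bounded_operator_mul1 : left_id bounded_operator_one bounded_operator_mul.
Proof. by move=> S; exact: bounded_operator_ext. Qed.

Lemma bounded_operator_mulr1 :
  right_id bounded_operator_one bounded_operator_mul.
Proof. by move=> S; exact: bounded_operator_ext. Qed.

Lemma bounded_operator_mulDl :
  left_distributive bounded_operator_mul +%R.
Proof. by move=> S T U; exact: bounded_operator_ext. Qed.

Lemma bounded_operator_mulDr :
  right_distributive bounded_operator_mul +%R.
Proof.
by move=> S T U; apply: bounded_operator_ext => x; exact: (linearD S).
Qed.

HB.instance Definition _ := GRing.Zmodule_isPzRing.Build bounded_operator
  bounded_operator_mulA bounded_operator_mul1 bounded_operator_mulr1
  bounded_operator_mulDl bounded_operator_mulDr.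

Lemma bounded_operator_scaleAl (a : K) S T : a *: (S * T) = a *: S * T.
Proof. exact: bounded_operator_ext. Qed.

Lemma bounded_operator_scaleAr (a : K) S T : a *: (S * T) = S * (a *: T).
Proof.
by apply: bounded_operator_ext => x; exact/esym/(linearZ_LR S).
Qed.

End BoundedOperators.

Notation "''B' ( H )" := (bounded_operator H)
  (at level 8, format "''B' ( H )") : type_scope.

Section OperatorNorm.
Variables (R : realType) (k : scalar_kind).
Local Notation K := (scalars R k).
Variable H : normedModType K.
Implicit Types S T : 'B(H).

Definition operator_norm T : K :=
  scalar_of_real k (sup [set scalar_re `|T x| | x in [set x | `|x| <= 1]]).

Local Notation norms T := [set scalar_re `|T x| | x in [set x | `|x| <= 1]].

Let norms_neq0 T : norms T !=set0.
Proof. by exists (scalar_re `|T 0|), 0 => //=; rewrite normr0. Qed.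

Let bounded_by T (c : R) :
  (forall x, `|T x| <= scalar_of_real k c * `|x|) -> 0 <= c -> ubound (norms T) c.
Proof.
move=> Tc c0 _ [x /= x1 <-].
rewrite -(scalar_of_real_le k) scalar_reK// (le_trans (Tc x))//.
by rewrite ler_piMr// -(scalar_of_real0 R k) scalar_of_real_le.
Qed.

Let norms_sup T : has_sup (norms T).
Proof.
split; first exact: norms_neq0.
have [C TC] := bounded_operator_bounded T.
exists (scalar_re `|C|); apply: bounded_by; last first.
  by rewrite -(scalar_of_real_le k) scalar_of_real0 scalar_reK.
move=> x; rewrite scalar_reK//.
have [->|x0] := eqVneq x 0; first by rewrite linear0 !normr0 mulr0.
rewrite (le_trans (TC x))// ler_wpM2r// real_ler_norm// realE.
have x_gt0 : 0 < `|x| by rewrite normr_gt0.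
by have := le_trans (normr_ge0 _) (TC x); rewrite pmulr_lge0// => ->.
Qed.

Lemma operator_norm_ge0 T : 0 <= operator_norm T.
Proof.
rewrite -(scalar_of_real0 R k) scalar_of_real_le.
apply: le_trans (ub_le_sup (norms_sup T).2 _).
2: by exists 0; [rewrite /= normr0|reflexivity].
by rewrite linear0 normr0 -(scalar_of_real0 R k) scalar_of_realK.
Qed.

Lemma operator_norm_le T x : `|T x| <= operator_norm T * `|x|.
Proof.
have [->|x0] := eqVneq x 0; first by rewrite linear0 !normr0 mulr0.
have x_gt0 : 0 < `|x| by rewrite normr_gt0.
rewrite -ler_pdivrMr// mulrC.
have -> : `|x|^-1 * `|T x| = `|T (`|x|^-1 *: x)|.
  by rewrite linearZ/= normrZ normfV normr_id.
rewrite -[leLHS]scalar_reK// scalar_of_real_le.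
apply: (ub_le_sup (norms_sup T).2); exists (`|x|^-1 *: x) => //=.
by rewrite normrZ normfV normr_id mulVf// gt_eqF.
Qed.

Lemma operator_norm_le_bound T (c : K) :
  0 <= c -> (forall x, `|T x| <= c * `|x|) -> operator_norm T <= c.
Proof.
move=> c0 Tc; rewrite -[leRHS]scalar_reK// scalar_of_real_le.
apply: ge_sup; first exact: norms_neq0.
apply: bounded_by; first by rewrite scalar_reK.
by rewrite -(scalar_of_real_le k) scalar_of_real0 scalar_reK.
Qed.

Let operator_normD S T :
  operator_norm (S + T) <= operator_norm S + operator_norm T.
Proof.
apply: operator_norm_le_bound => [|x].
  by rewrite addr_ge0// operator_norm_ge0.
by rewrite (le_trans (ler_normD _ _))// mulrDl lerD// operator_norm_le.
Qed.

Let operator_normZ_le (a : K) T :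
  operator_norm (a *: T) <= `|a| * operator_norm T.
Proof.
apply: operator_norm_le_bound => [|x].
  by rewrite mulr_ge0// operator_norm_ge0.
by rewrite [leLHS]normrZ -mulrA ler_wpM2l// operator_norm_le.
Qed.

Let operator_normZ (a : K) T : operator_norm (a *: T) = `|a| * operator_norm T.
Proof.
apply/eqP; rewrite eq_le operator_normZ_le/=.
have [->|a0] := eqVneq a 0; first by rewrite normr0 mul0r operator_norm_ge0.
rewrite -ler_pdivlMl ?normr_gt0// -normfV -{1}(scale1r T) -(mulVf a0).
by rewrite -scalerA operator_normZ_le.
Qed.

Let operator_norm_eq0 T : operator_norm T = 0 -> T = 0.
Proof.
move=> T0; apply: bounded_operator_ext => x; apply/normr0_eq0/eqP.
by rewrite eq_le normr_ge0 andbT -(mul0r `|x|) -T0 operator_norm_le.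
Qed.

HB.instance Definition _ := Lmodule_isNormed.Build K 'B(H)
  operator_normD operator_normZ operator_norm_eq0.

Lemma operator_normE T : `|T| = operator_norm T.
Proof. by []. Qed.

End OperatorNorm.

(* As for {dot _ for _}, inner is linear in its first argument and
   conjugate-linear in its second one. *)
Record hilbertSpace (R : realType) (k : scalar_kind) := HilbertSpace {
  hilbert_space_sort :> completeNormedModType (scalars R k);
  inner : {dot hilbert_space_sort for @scalar_conj R k};
  normr_inner : forall x : hilbert_space_sort, `|x| ^+ 2 = inner x x
}.

Section Subspaces.
Variables (K : numFieldType) (V : normedModType K).
Implicit Types L X : set V.

Definition subspace_set L := L 0 /\
  forall (a : K) x y, L x -> L y -> L (a *: x + y).

Definition closed_subspace L := subspace_set L /\ closed L.

Definition closed_span X := closure (smallest subspace_set X).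

Definition nontrivial_subspace L := L <> [set 0] /\ L <> [set: V].

Definition subspace_lattice (Lat : set (set V)) :=
  [/\ Lat `<=` closed_subspace,
      forall F, F `<=` Lat -> Lat (\bigcap_(L in F) L),
      forall F, F `<=` Lat -> Lat (closed_span (\bigcup_(L in F) L)),
      Lat [set 0] & Lat [set: V]].

Definition nontrivial_lattice (Lat : set (set V)) :=
  Lat <> [set [set 0]; [set: V]].

Definition Alg (Lat : set (set V)) : set 'B(V) :=
  [set T : 'B(V) | forall L, Lat L -> T @` L `<=` L].

(* A map D -> D is represented by a total function on V, whose values outside D
   are irrelevant. *)
Definition continuous_linear_on (D : set V) (f : V -> V) :=
  [/\ set_fun D D f,
      forall (a : K) x y, D x -> D y -> f (a *: x + y) = a *: f x + f y &
      {within D, continuous f}].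

End Subspaces.

Section OrthogonalProjection.
Variables (R : realType) (k : scalar_kind) (H : hilbertSpace R k).

(* The default value 0 is reached only when L is not a closed subspace. *)
Definition orthogonal_projection (L : set H) : 'B(H) :=
  xget 0 [set P : 'B(H) | forall x,
    L (P x) /\ forall y, L y -> inner H (x - P x) y = 0].

Definition commutative_subspace_lattice (Lat : set (set H)) :=
  subspace_lattice Lat /\
  forall L M, Lat L -> Lat M ->
    GRing.comm (orthogonal_projection L) (orthogonal_projection M).

End OrthogonalProjection.

(* Main.v *)
(* Write P for the projection onto L and Q = 1 - P; every A in Alg Lat satisfies
   QAP = 0.  Testing the hypothesis on A = zP + c, B = z^-1 P / 2, with z
   invertible and c in the Q-corner, gives P delta(c) = 0 and
   z phi(z^-1) + z^-1 phi(z) = 0 for phi(z) = delta(zP), so that by Hua's identity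
   phi is a Jordan left derivation: phi(z^2) = 2 z phi(z).  Testing it on
   A = P + m, B = (P - m - md + d) / 2 handles the corner P Alg Q.

   The main point is that a continuous Jordan left derivation phi of a CSL algebra
   vanishes.  If c, s are commuting symmetric operators with c^2 + s^2 = 1, angle
   doubling multiplies |phi(c) v|^2 + |phi(s) v|^2 by 4 while continuity keeps it
   bounded; the Cayley transform then shows phi = 0 on symmetric operators.  If k is
   skew then k^2 is symmetric, so k phi(k) = 0, and the projection onto ker k
   shows phi(k) = 0; hence phi = 0 on the commutant of the lattice.  Finally phi
   takes its values in the subspace N killed by all e y (1 - e), where e is the
   projection onto a member of Lat and y is in Alg Lat; on N the algebra commutes
   with the lattice, which reduces everything to the commutant. *)

Require Import Defs.
From mathcomp Require Import all_boot all_order all_algebra.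
From mathcomp Require Import complex ring.
From mathcomp Require Import all_classical all_reals all_analysis.

Import Order.TTheory GRing.Theory Num.Theory.
Import numFieldNormedType.Exports.

Local Open Scope classical_set_scope.
Local Open Scope ring_scope.

(** * Conjugation and real parts, uniformly over real and complex scalars *)

Section Scalars.
Context {R : realType} {k : scalar_kind}.
Local Notation K := (scalars R k).
Implicit Types a b : K.

Lemma scalar_conjM a b : scalar_conj (a * b) = scalar_conj a * scalar_conj b.
Proof. by case: k a b => //= a b; rewrite rmorphM. Qed.

Lemma scalar_conjD a b : scalar_conj (a + b) = scalar_conj a + scalar_conj b.
Proof. by case: k a b => //= a b; rewrite rmorphD. Qed.

Lemma scalar_conjN a : scalar_conj (- a) = - scalar_conj a.
Proof. by case: k a => //= a; rewrite rmorphN. Qed.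

Lemma scalar_conjK a : scalar_conj (scalar_conj a) = a.
Proof. by case: k a => //= a; rewrite conjcK. Qed.

Lemma scalar_conj0 : scalar_conj (0 : K) = 0.
Proof. by apply: (addrI (scalar_conj 0)); rewrite -scalar_conjD !addr0. Qed.

Lemma mul_scalar_conj a : a * scalar_conj a = `|a| ^+ 2.
Proof. by case: k a => //= a; rewrite ?sqr_normc// -normrX ger0_norm ?sqr_ge0. Qed.

Lemma scalar_conj_ge0 a : 0 <= a -> scalar_conj a = a.
Proof. by case: k a => //= a a0; exact: geC0_conj. Qed.

Lemma scalar_re_ge0 a : 0 <= a -> 0 <= scalar_re a.
Proof. by move=> a0; rewrite -(scalar_of_real_le k) scalar_reK// scalar_of_real0. Qed.

End Scalars.

Lemma dot_conj (K : numDomainType) (U : lmodType K) (theta : K -> K)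
  (f : {dot U for theta}) (x y : U) : f x y = theta (f y x).
Proof. by rewrite [LHS]hermitian_subproof expr0 mul1r. Qed.

(** * Cauchy-Schwarz and the parallelogram law *)

Section InnerProduct.
Context {R : realType} {k : scalar_kind} {H : hilbertSpace R k}.
Local Notation K := (scalars R k).
Implicit Types (x y z : H) (a : K).
Local Notation "<< x , y >>" := (inner H x y).

Lemma innerDl x y z : << x + y, z >> = << x, z >> + << y, z >>.
Proof. exact: linearDl. Qed.

Lemma innerZl a x y : << a *: x, y >> = a * << x, y >>.
Proof. exact: linearZl_LR. Qed.

Lemma inner_conj x y : << x, y >> = scalar_conj << y, x >>.
Proof. exact: dot_conj. Qed.

Lemma innerDr x y z : << x, y + z >> = << x, y >> + << x, z >>.
Proof. exact: linearDr. Qed.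

Lemma innerZr a x y : << x, a *: y >> = scalar_conj a * << x, y >>.
Proof. by rewrite inner_conj innerZl scalar_conjM -inner_conj. Qed.

Lemma innerBl x y z : << x - y, z >> = << x, z >> - << y, z >>.
Proof. exact: linearBl. Qed.

Lemma innerBr x y z : << x, y - z >> = << x, y >> - << x, z >>.
Proof. exact: linearBr. Qed.

Lemma inner0l x : << 0, x >> = 0.
Proof. exact: linear0l. Qed.

Lemma inner0r x : << x, 0 >> = 0.
Proof. exact: linear0r. Qed.

Lemma inner_eq0C x y : << x, y >> = 0 -> << y, x >> = 0.
Proof. by move=> xy0; rewrite inner_conj xy0 scalar_conj0. Qed.

Lemma normr_inner_eq0 x : << x, x >> = 0 -> x = 0.
Proof.
by move=> xx0; apply/eqP; rewrite -normr_eq0 -sqrf_eq0 normr_inner xx0.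
Qed.

(* The residual of the orthogonal projection onto the line of y. *)
Lemma normr_residual x y a : << y, y >> != 0 -> a = << x, y >> / << y, y >> ->
  `|x| ^+ 2 = `|x - a *: y| ^+ 2 + `|<< x, y >>| ^+ 2 / << y, y >>.
Proof.
move=> yy0 ->.
rewrite !normr_inner innerBl !innerBr !innerZl !innerZr -mul_scalar_conj.
have yyC : scalar_conj << y, y >>^-1 = << y, y >>^-1.
  by apply: scalar_conj_ge0; rewrite invr_ge0 -normr_inner exprn_ge0.
rewrite scalar_conjM yyC [<< y, x >>]inner_conj.
rewrite mulrAC -[in X in _ - _ - X]mulrA mulVf// mulr1 subrr subr0.
by rewrite (mulrC (scalar_conj _)) subrK.
Qed.

(** By [normr_residual], [|x| ^+ 2] exceeds [|<< x, y >>| ^+ 2 / << y, y >>] by the square of a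
    residual. *)
Lemma cauchy_schwarz x y : `|<< x, y >>| <= `|x| * `|y|.
Proof.
have [->|y0] := eqVneq y 0; first by rewrite inner0r !normr0 mulr0.
have yy0 : << y, y >> != 0 by apply/eqP => /normr_inner_eq0; exact/eqP.
rewrite -(@ler_pXn2r _ 2%N)// ?nnegrE ?mulr_ge0// exprMn (normr_inner y).
rewrite -ler_pdivrMr; last by rewrite lt_def yy0 -normr_inner exprn_ge0.
by rewrite (normr_residual _ _ _ yy0 erefl) lerDr exprn_ge0.
Qed.

Lemma parallelogram x y :
  `|x + y| ^+ 2 + `|x - y| ^+ 2 = 2 * `|x| ^+ 2 + 2 * `|y| ^+ 2.
Proof.
have E (F : comNzRingType) (a b c d : F) :
    (a + b + (c + d)) + (a - b - (c - d)) = 2 * a + 2 * d by ring.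
by rewrite !normr_inner innerBl !innerBr innerDl !innerDr E.
Qed.

End InnerProduct.

(** * Nearest points in closed subspaces *)

Section BestApproximation.
Context {R : realType} {k : scalar_kind} {H : hilbertSpace R k}.
Local Notation K := (scalars R k).
Local Notation "<< x , y >>" := (inner H x y).

(** Complex scalars are only partially ordered, so the infimum is taken of the real parts, which
    determine the nonnegative values of [f]. *)
Lemma exists_inf (T : Type) (f : T -> K) (M : set T) :
  M !=set0 -> (forall u, M u -> 0 <= f u) -> exists D : K,
    (forall u, M u -> D <= f u) /\
    (forall e, 0 < e -> exists2 u, M u & f u < D + e).
Proof.
move=> [u0 Mu0] f0; pose E := (@scalar_re R k \o f) @` M.
have lbE : lbound E 0 by move=> _ [u Mu <-]; exact/scalar_re_ge0/f0.
have infE : has_inf E by split; [exists (scalar_re (f u0)), u0|exists 0].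
exists (scalar_of_real k (inf E)); split=> [u Mu|e e0].
  rewrite -[leRHS]scalar_reK ?f0// scalar_of_real_le.
  by apply: (ge_inf infE.2); exists u.
have re0 : 0 < scalar_re e.
  rewrite lt_def scalar_re_ge0 ?ltW// andbT; apply/eqP => re0.
  by move: (e0); rewrite -[e]scalar_reK ?ltW// re0 scalar_of_real0 ltxx.
have [_ [u Mu <-] ufe] := inf_adherent re0 infE.
exists u => //; rewrite -[ltLHS]scalar_reK ?f0// -[e]scalar_reK ?ltW//.
rewrite -scalar_of_realD lt_def scalar_of_real_le (ltW ufe) andbT.
apply/eqP => /(congr1 (@scalar_re R k)); rewrite !scalar_of_realK => ufE.
by rewrite /= ufE ltxx in ufe.
Qed.

Lemma le_linear_eq0 (X A : K) : 0 <= X -> 0 <= A ->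
  (forall e, 0 < e -> X <= e * A) -> X = 0.
Proof.
move=> X0 A0 XA; apply/eqP; apply/negP => /negP Xn0.
have Xgt0 : 0 < X by rewrite lt_def Xn0.
have A1 : 0 < A + 1 by rewrite ltr_wpDl.
(* For this [e] the bound would say [A + 1 <= A]. *)
have := XA (X / (A + 1)) (divr_gt0 Xgt0 A1).
by rewrite -mulrA ler_pMr// mulrC ler_pdivlMr// mul1r gerDl ler10.
Qed.

(* T = 1 is the projection theorem; taking T bounded below on M also yields the
   Lax-Milgram type statement coercive_onto. *)
Lemma exists_orthogonal_residual (M : set H) (T : 'B(H)) (c : K) (v : H) :
  closed_subspace M -> 0 < c -> (forall u, M u -> c * `|u| <= `|T u|) ->
  exists2 u, M u & forall y, M y -> << v - T u, T y >> = 0.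
Proof.
move=> [[M0 Mlin] Mcl] c0 cT.
have MD x y : M x -> M y -> M (x + y).
  by move=> Mx My; rewrite -[x]scale1r; exact: Mlin.
have MZ a x : M x -> M (a *: x).
  by move=> Mx; rewrite -[_ *: _]addr0; exact: Mlin.
have MB x y : M x -> M y -> M (x - y).
  by move=> Mx My; apply: MD => //; rewrite -scaleN1r; exact: MZ.
pose f u := `|v - T u| ^+ 2.
have [||D [Dle Dinf]] := @exists_inf _ f M.
- by exists 0.
- by move=> u _; rewrite exprn_ge0.
pose S e := [set u | M u /\ f u < D + e].
(* Near-minimizers are close to each other: the midpoint of [u] and [u'] lies in [M], so [D] bounds
   [f] there, and the parallelogram law bounds [|T (u' - u)|]; the lower bound [c] carries this back
   to [u - u']. *)
have Sball e u u' : S e u -> S e u' -> (c * `|u - u'|) ^+ 2 <= 4 * e.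
  move=> [Mu fu] [Mu' fu'].
  have pl := parallelogram (v - T u) (v - T u').
  have dE : v - T u - (v - T u') = T (u' - u).
    by rewrite [RHS](linearB T) opprB addrC addrA subrK.
  rewrite dE in pl.
  have half : `|v - T u + (v - T u')| ^+ 2 = 4 * f (2^-1 *: (u + u')).
    rewrite /f (linearZ_LR T) (linearD T).
    have -> : v - T u + (v - T u') = 2 *: (v - 2^-1 *: (T u + T u')).
      rewrite scalerBr scalerA divff ?pnatr_eq0// scale1r scaler_nat mulr2n.
      by rewrite opprD addrACA.
    by rewrite normrZ exprMn normr_nat -natrX.
  have le1 : (c * `|u - u'|) ^+ 2 <= `|T (u' - u)| ^+ 2.
    rewrite ler_pXn2r ?nnegrE ?mulr_ge0 ?(ltW c0)// distrC.
    exact/cT/MB.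
  apply: (le_trans le1).
  have -> : `|T (u' - u)| ^+ 2 = 2 * f u + 2 * f u' - 4 * f (2^-1 *: (u + u')).
    by rewrite -pl -half addrAC subrr add0r.
  have Dm := Dle _ (MZ 2^-1 _ (MD _ _ Mu Mu')).
  have -> : 4 * e = 2 * (D + e) + 2 * (D + e) - 4 * D.
    have E (F : comNzRingType) (a b : F) :
      4 * b = 2 * (a + b) + 2 * (a + b) - 4 * a by ring.
    exact: E.
  by apply: lerB; [apply: lerD|]; apply: ler_wpM2l; rewrite ?ler0n//; exact: ltW.
(* Moving [u] by the optimal multiple of [y] lowers [f] by [|<< v - T u, T y >>| ^+ 2 / << T y, T y
   >>], which cannot exceed [e] because [f u < D + e]. *)
have Sorth e u y : 0 < e -> S e u -> M y ->
    `|<< v - T u, T y >>| ^+ 2 <= e * `|T y| ^+ 2.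
  move=> e0 [Mu fu] My.
  have [Ty0|Ty0] := eqVneq << T y, T y >> 0.
    by rewrite (normr_inner_eq0 _ Ty0) inner0r !normr0 expr0n mulr0.
  have Tygt0 : 0 < << T y, T y >>.
    by rewrite lt_def Ty0 -normr_inner exprn_ge0.
  have := normr_residual (v - T u) (T y) _ Ty0 erefl.
  set a := _ / _ => res.
  rewrite (normr_inner (T y)) -ler_pdivrMr// -(lerD2l (`|v - T u - a *: T y| ^+ 2)).
  rewrite -res; apply: (le_trans (ltW fu)); rewrite lerD2r.
  have -> : v - T u - a *: T y = v - T (u + a *: y).
    by rewrite (linearD T) (linearZ_LR T) opprD addrA.
  exact/Dle/MD/MZ.
pose F := filter_from [set e : K | 0 < e] S.
have S_incl e e' : e <= e' -> S e `<=` S e'.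
  by move=> ee' u [Mu fu]; split=> //; rewrite (lt_le_trans fu)// lerD2l.
(* The quotient [e * e' / (e + e')] is a positive number below both [e] and [e'] and serves as their
   minimum. *)
have harm (e e' : K) : 0 < e -> 0 < e' -> e * e' / (e + e') <= e.
  by move=> e0 e'0; rewrite ler_pdivrMr ?addr_gt0// ler_pM2l// lerDr ltW.
have S_directed (e e' : K) : 0 < e -> 0 < e' ->
    exists2 d, 0 < d & S d `<=` S e `&` S e'.
  move=> e0 e'0; exists (e * e' / (e + e')).
    by rewrite divr_gt0 ?mulr_gt0 ?addr_gt0.
  rewrite subsetI; split; apply: S_incl; first exact: harm.
  by rewrite (mulrC e) (addrC e); exact: harm.
have FF : ProperFilter F.
  apply: filter_from_proper => [|e /= e0]; last first.
    by have [u Mu fu] := Dinf _ e0; exists u.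
  by apply: filter_from_filter => //; exists 1; exact: ltr01.
have SF e : 0 < e -> F (S e) by move=> e0; exists e.
have FM : F M by exists 1 => [|u []//]; exact: ltr01.
have Fcvg : cvg F.
  apply: cauchy_cvg; apply: cauchy_exP => eps eps0.
  (* With this [e], [Sball] bounds the square by half of [(c * eps) ^+ 2]. *)
  pose e := (c * eps) ^+ 2 / 8.
  have e0 : 0 < e by rewrite divr_gt0 ?ltr0n// exprn_gt0// mulr_gt0.
  have [u Mu fu] := Dinf _ e0; exists u.
  exists e => // u' Su'; rewrite -ball_normE /=.
  have : (c * `|u - u'|) ^+ 2 < (c * eps) ^+ 2.
    apply: (le_lt_trans (Sball _ _ _ _ Su')) => //.
    rewrite /e mulrCA gtr_pMr ?exprn_gt0 ?mulr_gt0//.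
    by rewrite ltr_pdivrMr ?ltr0n// mul1r ltr_nat.
  by rewrite ltr_pXn2r ?nnegrE ?mulr_ge0 ?(ltW c0) ?(ltW eps0)// ltr_pM2l.
set u := lim F in Fcvg.
have Mu : M u.
  by apply: Mcl => B /Fcvg FB; exact: (filter_ex (filterI FM FB)).
exists u => // y My.
have X0 := normr_ge0 << v - T u, T y >>.
apply/normr0_eq0/(@le_linear_eq0 _ (`|T y| + operator_norm T * `|T y|)) => // [|d d0].
  by rewrite addr_ge0// mulr_ge0// operator_norm_ge0.
have FB : F (ball u d) by apply: Fcvg; exact: nbhsx_ballx.
(* A near-minimizer [w] within [d] of the limit: both summands of [v - T u = (v - T w) - T (u - w)]
   have an inner product with [T y] that is linear in [d]. *)
have [w [Sw]] := filter_ex (filterI (SF _ (exprn_gt0 2 d0)) FB).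
rewrite -ball_normE /= => uwd.
have -> : v - T u = (v - T w) - T (u - w).
  by rewrite (linearB T) opprB addrA subrK.
rewrite innerBl (le_trans (ler_normB _ _))// mulrDr lerD//.
  rewrite -(@ler_pXn2r _ 2%N)// ?nnegrE ?mulr_ge0 ?(ltW d0)// exprMn.
  exact: Sorth (exprn_gt0 2 d0) Sw My.
rewrite (le_trans (cauchy_schwarz _ _))// mulrA ler_wpM2r//.
by rewrite (le_trans (operator_norm_le _ _))// mulrC ler_wpM2r ?operator_norm_ge0// ltW.
Qed.
End BestApproximation.

(** A linear relation with such a bound is single-valued: the difference of two images of [x] is an
    image of 0. Projections, inverses and adjoints are all built this way from pointwise
    existence. *)
Lemma bounded_operator_of_graph (K : numFieldType) (V : normedModType K)
    (G : V -> V -> Prop) (C : K) :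
  (forall x, exists y, G x y) -> (forall x y, G x y -> `|y| <= C * `|x|) ->
  (forall (a : K) x y x' y',
     G x x' -> G y y' -> G (a *: x + y) (a *: x' + y')) ->
  exists T : 'B(V), forall x, G x (T x).
Proof.
move=> /choice[f Gf] GC Glin.
have Guniq x y y' : G x y -> G x y' -> y = y'.
  move=> Gy Gy'; have := GC _ _ (Glin (-1) _ _ _ _ Gy' Gy).
  rewrite !scaleN1r addNr normr0 mulr0 normr_le0 addrC subr_eq0.
  by move=> /eqP.
have fP : f \in @bounded_linear_pred _ V.
  apply/asboolP; split=> [a x y|]; last by exists C => x; exact: GC.
  exact: Guniq (Gf _) (Glin _ _ _ _ _ (Gf _) (Gf _)).
by exists (BoundedOperator fP).
Qed.

(** * Orthogonal projections, coercive operators and adjoints *)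

Section Hilbert.
Context {R : realType} {k : scalar_kind} {H : hilbertSpace R k}.
Local Notation K := (scalars R k).
Local Notation "<< x , y >>" := (inner H x y).
Implicit Types (x y z : H) (M N : set H) (S T : 'B(H)).

Lemma operatorB S T x : (S - T) x = S x - T x. Proof. by []. Qed.
Lemma operatorD S T x : (S + T) x = S x + T x. Proof. by []. Qed.
Lemma operatorM S T x : (S * T) x = S (T x). Proof. by []. Qed.
Lemma operatorZ (a : K) T x : (a *: T) x = a *: T x. Proof. by []. Qed.
Lemma operator1 x : (1 : 'B(H)) x = x. Proof. by []. Qed.

Lemma closed_null_set (n : H -> K) (C : K) : (forall x, 0 <= n x) -> 0 <= C ->
  (forall x y, n x <= n y + C * `|x - y|) -> closed [set x | n x = 0].
Proof.
move=> n0 C0 nC x clx /=; apply: (@le_linear_eq0 _ _ (n x) C) => // d d0.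
have [y [/= ny0]] := clx _ (nbhsx_ballx x d d0).
rewrite -ball_normE /= => xyd.
by rewrite (le_trans (nC x y))// ny0 add0r mulrC ler_wpM2r// ltW.
Qed.

Lemma closed_subspace_bigcap (I : Type) (D : set I) (F : I -> set H) :
  (forall i, D i -> closed_subspace (F i)) ->
  closed_subspace (\bigcap_(i in D) F i).
Proof.
move=> Fcl; split; last by apply: closed_bigI => i /Fcl[].
split=> [i Di|a x y Fx Fy i Di]; first by have [[]] := Fcl i Di.
by have [[_ Flin] _] := Fcl i Di; apply: Flin; [exact: Fx|exact: Fy].
Qed.

Lemma closed_subspace_orthogonal T x : closed_subspace [set y | << T y, x >> = 0].
Proof.
split; first split => [|a y z /= yx zx] /=.
- by rewrite linear0 inner0l.
- by rewrite (linearP T) innerDl innerZl yx zx mulr0 addr0.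
have -> : [set y | << T y, x >> = 0] = [set y | `|<< T y, x >>| = 0].
  by apply/seteqP; split=> y /=; [move=> ->; rewrite normr0|exact: normr0_eq0].
apply: (@closed_null_set _ (operator_norm T * `|x|)) => [y||y z].
- exact: normr_ge0.
- by rewrite mulr_ge0// operator_norm_ge0.
rewrite addrC -lerBlDr (le_trans (lerB_dist _ _))// -innerBl -(linearB T).
rewrite (le_trans (cauchy_schwarz _ _))// mulrAC ler_wpM2r//.
exact: operator_norm_le.
Qed.

Lemma closed_subspace_ker T : closed_subspace [set x | T x = 0].
Proof.
have -> : [set x | T x = 0] = \bigcap_(y in setT) [set x | << T x, y >> = 0].
  apply/seteqP; split=> x /= => [Tx y _ /=|Tx]; first by rewrite Tx inner0l.
  exact/normr_inner_eq0/Tx.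
by apply: closed_subspace_bigcap => y _; exact: closed_subspace_orthogonal.
Qed.

(** Ensures that [xget] in [orthogonal_projection] finds a genuine projection. Existence is the case
    [T = 1] of [exists_orthogonal_residual]; the bound 1 comes from [|p| ^+ 2 = << x, p >>] and
    Cauchy-Schwarz. *)
Lemma orthogonal_projectionP M x : closed_subspace M ->
  M (orthogonal_projection M x) /\
  forall y, M y -> << x - orthogonal_projection M x, y >> = 0.
Proof.
move=> clM; have [Mlin _] := clM.
pose G x p := M p /\ forall y, M y -> << x - p, y >> = 0.
suff [P GP] : exists P : 'B(H), forall x, G x (P x).
  by apply: (xgetPex 0 (P := [set P : 'B(H) | forall x, G x (P x)])); exists P.
apply: (@bounded_operator_of_graph _ _ _ 1) => [{}x|{}x p [Mp xp]|a {}x y p q].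
- have [|u Mu uP] := @exists_orthogonal_residual _ _ _ M 1 1 x clM ltr01.
    by move=> u _; rewrite mul1r.
  by exists u; split.
- rewrite mul1r; have [->|p0] := eqVneq p 0; first by rewrite normr0.
  have pp : `|p| ^+ 2 = << x, p >>.
    rewrite normr_inner; apply/esym/eqP; rewrite -subr_eq0 -innerBl.
    exact/eqP/xp.
  have p_gt0 : 0 < `|p| by rewrite normr_gt0.
  rewrite -(ler_pM2r p_gt0) -expr2 -[leLHS]ger0_norm ?exprn_ge0// pp.
  exact: cauchy_schwarz.
move=> [Mp xp] [Mq yq]; split=> [|z Mz]; first exact: Mlin.2.
by rewrite opprD addrACA -scalerBr innerDl innerZl xp// yq// mulr0 addr0.
Qed.

Lemma orthogonal_projection_uniq M x p : closed_subspace M -> M p ->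
  (forall y, M y -> << x - p, y >> = 0) -> orthogonal_projection M x = p.
Proof.
move=> clM Mp xp; have [Mx xM] := orthogonal_projectionP _ x clM.
have [[_ Mlin] _] := clM.
have MB : M (p - orthogonal_projection M x).
  by rewrite addrC -scaleN1r; exact: Mlin.
apply/esym/eqP; rewrite -subr_eq0; apply/eqP/normr_inner_eq0.
have {1}-> : p - orthogonal_projection M x
    = x - orthogonal_projection M x - (x - p).
  by rewrite opprB [RHS]addrC addrA subrK.
by rewrite innerBl xM// xp// subr0.
Qed.

Lemma orthogonal_projection_id M x : closed_subspace M -> M x ->
  orthogonal_projection M x = x.
Proof.
move=> clM Mx; apply: orthogonal_projection_uniq => // y My.
by rewrite subrr inner0l.
Qed.

Lemma orthogonal_projection_sym M x y : closed_subspace M ->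
  << orthogonal_projection M x, y >> = << x, orthogonal_projection M y >>.
Proof.
move=> clM; have [Mx xM] := orthogonal_projectionP _ x clM.
have [My yM] := orthogonal_projectionP _ y clM.
transitivity << orthogonal_projection M x, orthogonal_projection M y >>.
  apply/eqP; rewrite -subr_eq0 -innerBr; apply/eqP/inner_eq0C/yM/Mx.
by apply/esym/eqP; rewrite -subr_eq0 -innerBl; apply/eqP/xM/My.
Qed.

Lemma orthogonal_projection_idem M : closed_subspace M ->
  orthogonal_projection M * orthogonal_projection M = orthogonal_projection M.
Proof.
move=> clM; apply: bounded_operator_ext => x; rewrite operatorM.
by rewrite orthogonal_projection_id//; have [] := orthogonal_projectionP _ x clM.
Qed.

Lemma coercive_bounded_below T (c : K) : 0 < c ->
  (forall x, c * `|x| ^+ 2 <= `|<< T x, x >>|) -> forall x, c * `|x| <= `|T x|.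
Proof.
move=> c0 cT x; have [->|x0] := eqVneq x 0; first by rewrite normr0 mulr0.
have x_gt0 : 0 < `|x| by rewrite normr_gt0.
rewrite -(ler_pM2r x_gt0) -mulrA -expr2 (le_trans (cT x))//.
exact: cauchy_schwarz.
Qed.

(** The residual [r = y - T x] lies in the invariant subspace [M] and is orthogonal to [T r], so
    coercivity forces [r = 0]. *)
Lemma coercive_onto T (c : K) M y : 0 < c ->
  (forall x, c * `|x| ^+ 2 <= `|<< T x, x >>|) ->
  closed_subspace M -> (forall x, M x -> M (T x)) -> M y ->
  exists2 x, M x & T x = y.
Proof.
move=> c0 cT clM TM My; have [[_ Mlin] _] := clM.
have [|x Mx xM] := @exists_orthogonal_residual _ _ _ M T c y clM c0.
  by move=> x _; exact: coercive_bounded_below.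
exists x => //; apply/esym/eqP; rewrite -subr_eq0; apply/eqP.
set r := y - T x in xM *.
have Mr : M r by rewrite /r addrC -scaleN1r; apply: Mlin => //; exact: TM.
have := cT r; rewrite (inner_eq0C _ _ (xM r Mr)) normr0 pmulr_rle0// => rle0.
by apply/eqP; rewrite -normr_eq0 -sqrf_eq0 eq_le rle0 exprn_ge0.
Qed.

(** Solving [T x = y] inside each member of [Lat], and not only in [H], is what makes the inverse
    leave the lattice invariant. *)
Lemma coercive_inverse (Lat : set (set H)) T (c : K) :
  Lat `<=` @closed_subspace _ H -> Lat [set: H] -> Alg Lat T -> 0 < c ->
  (forall x, c * `|x| ^+ 2 <= `|<< T x, x >>|) ->
  exists2 S, Alg Lat S & T * S = 1 /\ S * T = 1.
Proof.
move=> Lcl LT AT c0 cT; have Tbelow := coercive_bounded_below _ _ c0 cT.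
have onto M y : Lat M -> M y -> exists2 x, M x & T x = y.
  move=> LM My; apply: (coercive_onto _ _ _ _ c0 cT (Lcl _ LM)) => // x Mx.
  by apply: AT LM _ _; exists x.
have inj x y : T x = T y -> x = y.
  move=> Txy; apply/eqP; rewrite -subr_eq0 -normr_le0 -(pmulr_rle0 _ c0).
  by rewrite (le_trans (Tbelow _))// (linearB T) /= Txy subrr normr0.
have [||a x y x' y' <- <-|S TS] :=
    @bounded_operator_of_graph _ H (fun x y => T y = x) c^-1.
- by move=> x; have [y _ Tyx] := onto _ x LT I; exists y.
- by move=> x y <-; rewrite ler_pdivlMl.
- exact: linearP.
exists S; last first.
  by split; apply: bounded_operator_ext => x; [exact: TS|apply: inj; exact: TS].
move=> M LM _ [x Mx <-]; have [y My Tyx] := onto _ _ LM Mx.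
by rewrite -(inj y (S x))// TS.
Qed.

(** Riesz representation of the functional sending [x] to [<< T x, y >>]: unless it vanishes, it is
    represented by a multiple of a vector [z] orthogonal to its kernel [N]. *)
Lemma exists_adjoint T : exists S : 'B(H), forall x y, << T x, y >> = << x, S y >>.
Proof.
have [|y u Tu|a y z u v yu zv x|S TS] := @bounded_operator_of_graph _ H
    (fun y u => forall x, << T x, y >> = << x, u >>) (operator_norm T).
- move=> y; have [all0|] := pselect (forall x, << T x, y >> = 0).
    by exists 0 => x; rewrite all0 inner0r.
  move/existsNP => [x0 /eqP Tx0].
  pose N := [set x | << T x, y >> = 0].
  have clN : closed_subspace N by exact: closed_subspace_orthogonal.
  have [Np pN] := orthogonal_projectionP _ x0 clN.
  set z := x0 - _ in pN; have Tz : << T z, y >> = << T x0, y >>.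
    by rewrite /z (linearB T) innerBl Np subr0.
  have zz0 : << z, z >> != 0.
    by apply: contra Tx0 => /eqP/normr_inner_eq0 z0; rewrite -Tz z0 linear0 inner0l.
  exists (scalar_conj (<< T z, y >> / << z, z >>) *: z) => x.
  rewrite innerZr scalar_conjK.
  have : << x - (<< T x, y >> / << T z, y >>) *: z, z >> = 0.
    apply/inner_eq0C/pN; rewrite /N /=.
    by rewrite (linearB T) (linearZ_LR T) innerBl innerZl divfK ?subrr// Tz.
  rewrite innerBl innerZl => /eqP; rewrite subr_eq0 => /eqP ->.
  by rewrite mulrACA mulVf// mulr1 mulrC divfK// Tz.
- have [->|u0] := eqVneq u 0.
    by rewrite normr0 mulr_ge0// operator_norm_ge0.
  have u_gt0 : 0 < `|u| by rewrite normr_gt0.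
  rewrite -(ler_pM2r u_gt0) -expr2 -[leLHS]ger0_norm ?exprn_ge0//.
  rewrite normr_inner -Tu (le_trans (cauchy_schwarz _ _))// mulrAC ler_wpM2r//.
  exact: operator_norm_le.
- by rewrite !innerDr !innerZr yu zv.
by exists S => x y; exact: TS.
Qed.

End Hilbert.

Lemma scalar_of_real_nat (R : realType) (k : scalar_kind) (n : nat) :
  scalar_of_real k n%:R = n%:R :> scalars R k.
Proof. by case: k => //=; rewrite rmorph_nat. Qed.

Lemma scalar_archimedean (R : realType) (k : scalar_kind) (x b : scalars R k) :
  0 <= x -> (forall n, n%:R * x <= b) -> x = 0.
Proof.
move=> x0 xb; have b0 : 0 <= b by rewrite (le_trans _ (xb 0)) ?mul0r.
apply/eqP/negP => /negP xn0.
have rx : 0 < scalar_re x.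
  rewrite lt_def scalar_re_ge0// andbT; apply: contra xn0 => /eqP rx0.
  by rewrite -[x]scalar_reK// rx0 scalar_of_real0.
pose n := Num.Def.archi_bound (scalar_re b / scalar_re x).
have : scalar_re b / scalar_re x < n%:R.
  by apply: archi_boundP; rewrite divr_ge0 ?scalar_re_ge0.
rewrite ltr_pdivrMr// ltNge => /negP; apply.
by rewrite -(scalar_of_real_le k) scalar_of_realM scalar_of_real_nat !scalar_reK.
Qed.

(** * Continuity and boundedness of linear maps on a subspace *)

Section ContinuousLinearOn.
Context {K : numFieldType} {V : normedModType K}.
Variables (D : set V) (f : V -> V).
Hypothesis D_subspace : subspace_set D.
Hypothesis f_lin : forall (a : K) x y, D x -> D y -> f (a *: x + y) = a *: f x + f y.

Lemma linear_onD x y : D x -> D y -> f (x + y) = f x + f y.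
Proof. by move=> Dx Dy; rewrite -[x in LHS]scale1r f_lin// scale1r. Qed.

Lemma linear_on0 : f 0 = 0.
Proof.
have [D0 _] := D_subspace; have := linear_onD 0 0 D0 D0.
by rewrite addr0 -{1}[f 0]addr0 => /addrI.
Qed.

Lemma linear_onZ (a : K) x : D x -> f (a *: x) = a *: f x.
Proof.
move=> Dx; rewrite -[_ *: _ in LHS]addr0 f_lin//; last exact: D_subspace.1.
by rewrite linear_on0 addr0.
Qed.

Lemma linear_onN x : D x -> f (- x) = - f x.
Proof. by move=> Dx; rewrite -scaleN1r linear_onZ// scaleN1r. Qed.

Lemma continuous_on_bounded : {within D, continuous f} ->
  exists2 C : K, 0 <= C & forall x, D x -> `|f x| <= C * `|x|.
Proof.
have [D0 Dlin] := D_subspace.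
move=> /subspace_continuousP/(_ _ D0) cvf0.
have : f @ within D (nbhs 0) --> (0 : V) by rewrite -[X in _ --> X]linear_on0.
move=> /cvgr0Pnorm_lt/(_ _ ltr01).
rewrite near_withinE => /nbhs_ballP[d /= d0 dP].
exists (2 / d) => [|x Dx]; first by rewrite divr_ge0// ltW.
have [->|x0] := eqVneq x 0; first by rewrite linear_on0 !normr0 mulr0.
have x_gt0 : 0 < `|x| by rewrite normr_gt0.
(* Scaling by [a] brings [x] to norm [d / 2], inside the ball where [f] has norm below 1. *)
pose a := d / 2 / `|x|; have a0 : 0 < a by rewrite !divr_gt0.
have Da : D (a *: x) by rewrite -[_ *: _]addr0; exact: Dlin.
have : `|f (a *: x)| < 1.
  apply: dP => //; rewrite -ball_normE /= sub0r normrN normrZ gtr0_norm//.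
  by rewrite divfK ?gt_eqF// ltr_pdivrMr// ltr_pMr// ltr1n.
rewrite linear_onZ// normrZ gtr0_norm// => /ltW.
by rewrite /a mulrC -ler_pdivlMr ?divr_gt0// mul1r !invf_div mulrC.
Qed.

Lemma bounded_on_continuous (C : K) : 0 <= C ->
  (forall x, D x -> `|f x| <= C * `|x|) -> {within D, continuous f}.
Proof.
move=> C_ge0 fC; apply/subspace_continuousP => x Dx.
have [D0 Dlin] := D_subspace.
apply/cvgrPdist_lt => e e0; rewrite near_withinE; apply/nbhs_ballP.
have C0 : 0 < C + 1 by rewrite ltr_wpDl.
exists (e / (C + 1)) => [|y]; first exact: divr_gt0.
rewrite -ball_normE /= ltr_pdivlMr// => xy Dy.
have Dxy : D (x - y) by rewrite addrC -scaleN1r; exact: Dlin.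
have -> : f x - f y = f (x - y).
  by have := f_lin (-1) y x Dy Dx; rewrite !scaleN1r (addrC (- y)) (addrC (- f y)).
apply: le_lt_trans xy; rewrite (le_trans (fC _ Dxy))// mulrC.
by rewrite ler_wpM2l// lerDl.
Qed.

End ContinuousLinearOn.

(** * CSL-algebras and the commutant of the lattice *)

Section CSLAlgebra.
Context {R : realType} {k : scalar_kind} {H : hilbertSpace R k}.
Local Notation K := (scalars R k).
Local Notation "<< x , y >>" := (inner H x y).
Context {Lat : set (set H)} (hLat : commutative_subspace_lattice Lat).
Local Notation proj := orthogonal_projection.
Implicit Types (S T x y z : 'B(H)).

Lemma lattice_closed M : Lat M -> closed_subspace M.
Proof. by have [[Lcl _ _ _ _] _] := hLat; exact: Lcl. Qed.

Lemma AlgP T : Alg Lat T <-> forall M v, Lat M -> M v -> M (T v).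
Proof.
split=> [AT M v LM Mv|TM M LM _ [v Mv <-]]; last exact: TM.
by apply: AT LM _ _; exists v.
Qed.

Lemma Alg_lin (a : K) S T : Alg Lat S -> Alg Lat T -> Alg Lat (a *: S + T).
Proof.
move=> /AlgP AS /AlgP AT; apply/AlgP => M v LM Mv.
have [[_ Mlin] _] := lattice_closed _ LM.
by rewrite operatorD operatorZ; apply: Mlin; [exact: AS|exact: AT].
Qed.

Lemma Alg0 : Alg Lat 0.
Proof. by apply/AlgP => M v /lattice_closed[[M0 _] _] _. Qed.

Lemma Alg_subspace : subspace_set (Alg Lat).
Proof. by split=> [|a x y]; [exact: Alg0|exact: Alg_lin]. Qed.

Lemma Alg1 : Alg Lat 1.
Proof. exact/AlgP. Qed.

Lemma AlgD S T : Alg Lat S -> Alg Lat T -> Alg Lat (S + T).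
Proof. by move=> AS AT; rewrite -[S]scale1r; exact: Alg_lin. Qed.

Lemma AlgZ (a : K) S : Alg Lat S -> Alg Lat (a *: S).
Proof. by move=> AS; rewrite -[_ *: _]addr0; apply: Alg_lin => //; exact: Alg0. Qed.

Lemma AlgN S : Alg Lat S -> Alg Lat (- S).
Proof. by rewrite -scaleN1r; exact: AlgZ. Qed.

Lemma AlgMn S n : Alg Lat S -> Alg Lat (S *+ n).
Proof. by rewrite -scaler_nat; exact: AlgZ. Qed.

Lemma AlgM S T : Alg Lat S -> Alg Lat T -> Alg Lat (S * T).
Proof.
by move=> /AlgP AS /AlgP AT; apply/AlgP => M v LM Mv; apply: AS => //; exact: AT.
Qed.

(** This is the diagonal of the algebra, its intersection with the set of adjoints of its
    members. *)
Definition lattice_commutant (Lat : set (set H)) T :=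
  forall M, Lat M -> proj M * T = T * proj M.

Lemma commutant_Alg T : lattice_commutant Lat T -> Alg Lat T.
Proof.
move=> TC; apply/AlgP => M v LM Mv; have clM := lattice_closed _ LM.
rewrite -(orthogonal_projection_id _ v clM Mv) -operatorM -TC//.
by have [] := orthogonal_projectionP _ (T v) clM.
Qed.

(** Here the commutativity of the lattice enters; through it every lattice projection belongs to
    [Alg Lat]. *)
Lemma proj_commutant M : Lat M -> lattice_commutant Lat (proj M).
Proof. by move=> LM N LN; have [_ C] := hLat; exact: C. Qed.

Lemma Alg_proj M : Lat M -> Alg Lat (proj M).
Proof. by move=> LM; exact: commutant_Alg (proj_commutant _ LM). Qed.

Lemma Alg_projE T M : Alg Lat T -> Lat M -> proj M * T * proj M = T * proj M.
Proof.
move=> AT LM; have clM := lattice_closed _ LM.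
apply: bounded_operator_ext => v; rewrite !operatorM orthogonal_projection_id//.
by apply: (AlgP T).1 => //; have [] := orthogonal_projectionP _ v clM.
Qed.

(** The projections [proj M] are symmetric, so invariance of [N] under them passes to its orthogonal
    complement. *)
Lemma invariant_proj_commutant (N : set H) : closed_subspace N ->
  (forall M v, Lat M -> N v -> N (proj M v)) -> lattice_commutant Lat (proj N).
Proof.
move=> clN MN M LM; have clM := lattice_closed _ LM.
apply: bounded_operator_ext => v; rewrite !operatorM; apply/esym.
have [Nv vN] := orthogonal_projectionP _ v clN.
apply: orthogonal_projection_uniq => // [|w Nw]; first exact: MN.
by rewrite -(linearB (proj M)) orthogonal_projection_sym// vN//; exact: MN.
Qed.

End CSLAlgebra.

Ltac alg := repeat first [ assumption | apply: AlgM | apply: AlgD | apply: AlgN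
  | apply: AlgMn | apply: Alg1 | apply: Alg0 | apply: AlgZ].

(** * Vanishing of bounded Jordan left derivations on a CSL-algebra *)

Section JordanLeftDerivations.
Context {R : realType} {k : scalar_kind} {H : hilbertSpace R k}.
Local Notation K := (scalars R k).
Local Notation "<< x , y >>" := (inner H x y).
Context {Lat : set (set H)} (hLat : commutative_subspace_lattice Lat).
Local Notation proj := orthogonal_projection.
Implicit Types (S T x y z : 'B(H)).

Lemma operator_double_eq0 T : T *+ 2 = 0 -> T = 0.
Proof.
by rewrite -scaler_nat => /eqP; rewrite scaler_eq0 pnatr_eq0 => /eqP.
Qed.

Definition symmetric_operator T := forall v w : H, << T v, w >> = << v, T w >>.

(** The block matrix with rows [c, - s] and [s, c] acts isometrically on pairs of vectors; the cross
    terms cancel by symmetry and commutation. *)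
Lemma rotation_norm (c s : 'B(H)) (v w : H) :
  symmetric_operator c -> symmetric_operator s ->
  c * s = s * c -> c * c + s * s = 1 ->
  `|c v - s w| ^+ 2 + `|c w + s v| ^+ 2 = `|v| ^+ 2 + `|w| ^+ 2.
Proof.
move=> csym ssym cs cs1.
have cs1v u : c (c u) + s (s u) = u by rewrite -!operatorM -operatorD cs1.
have csv u : c (s u) = s (c u) by rewrite -!operatorM cs.
rewrite !normr_inner innerBl innerDl !csym !ssym.
rewrite [_ + << v, s _ >>]addrC addrACA -innerDr addrC [- _ + _]addrC -innerBr.
rewrite (linearB c) (linearB s) (linearD c) (linearD s) /= !csv.
by rewrite addrA subrK opprB addrACA subrr addr0 !cs1v addrC.
Qed.

(* c and s play the roles of the cosine and sine of a self-adjoint angle; this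
   substitutes for a functional calculus and works over both scalar fields. *)
Record rotation_pair (c s : 'B(H)) : Prop := RotationPair {
  rotation_Alg : Alg Lat c /\ Alg Lat s;
  rotation_sym : symmetric_operator c /\ symmetric_operator s;
  rotation_comm : c * s = s * c;
  rotation_sum : c * c + s * s = 1
}.

Lemma symmetricD S T : symmetric_operator S -> symmetric_operator T ->
  symmetric_operator (S + T).
Proof. by move=> Ss Ts v w; rewrite !operatorD innerDl innerDr Ss Ts. Qed.

Lemma symmetricN S : symmetric_operator S -> symmetric_operator (- S).
Proof.
move=> Ss v w; rewrite -scaleN1r !operatorZ innerZl innerZr Ss scalar_conjN.
by rewrite (scalar_conj_ge0 _ ler01).
Qed.

Lemma symmetricM S T : symmetric_operator S -> symmetric_operator T ->
  S * T = T * S -> symmetric_operator (S * T).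
Proof. by move=> Ss Ts ST v w; rewrite {2}ST !operatorM Ss Ts. Qed.

Lemma rotation_norm_le1 c s : rotation_pair c s -> `|c| <= 1 /\ `|s| <= 1.
Proof.
move=> [_ [csym ssym] cs cs1].
have E v : `|c v| ^+ 2 + `|s v| ^+ 2 = `|v| ^+ 2.
  have := rotation_norm c s v 0 csym ssym cs cs1.
  by rewrite (linear0 c) (linear0 s) subr0 add0r normr0 expr0n addr0.
have sq_le (a b : K) : 0 <= a -> 0 <= b -> a ^+ 2 <= b ^+ 2 -> a <= b.
  by move=> a0 b0; rewrite ler_pXn2r ?nnegrE.
split; rewrite operator_normE; apply: operator_norm_le_bound => // v;
  by rewrite mul1r sq_le// -[leRHS]E ?lerDl ?lerDr exprn_ge0.
Qed.

(** The double-angle formulas. With [a = c * c] and [b = s * s], the last field is the identity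
    [(a - b)^2 + 4 a b = (a + b)^2]. *)
Lemma rotation_double c s : rotation_pair c s ->
  rotation_pair (c * c - s * s) (c * s + s * c).
Proof.
move=> [[Ac As] [csym ssym] cs cs1].
pose a := c * c; pose b := s * s; pose d := c * s.
have ca : c * a = a * c by rewrite /a mulrA.
have sb : s * b = b * s by rewrite /b mulrA.
have csb : c * b = b * c by rewrite /b mulrA cs -mulrA cs mulrA.
have sa : s * a = a * s by rewrite /a mulrA -cs -mulrA -cs mulrA.
have ab : a * b = b * a by rewrite /a -mulrA csb mulrA csb mulrA.
have ad : a * d = d * a by rewrite /d mulrA -ca -mulrA -sa mulrA.
have bd : b * d = d * b by rewrite /d mulrA -csb -mulrA -sb mulrA.
have dd : d * d = a * b by rewrite /d /a /b -!mulrA (mulrA s) -cs !mulrA.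
split.
- by split; alg.
- split; last by apply: symmetricD; apply: symmetricM.
  by apply: symmetricD; [|apply: symmetricN]; apply: symmetricM.
- by rewrite -cs -/a -/b -/d -mulr2n mulrnAr mulrnAl [(a - b) * d]mulrBl ad bd -mulrBr.
- rewrite -cs -/a -/b -/d -mulr2n mulrnAl mulrnAr dd -mulrnA.
  have ab1 : (a + b) * (a + b) = 1 by rewrite cs1 mulr1.
  rewrite -{}ab1 [(a - b) * _]mulrBl [a * (a - b)]mulrBr [b * (a - b)]mulrBr.
  rewrite [RHS]mulrDl !mulrDr -ab.
  have zmod_id (x y t : 'B(H)) : x - t - (t - y) + t *+ 4 = x + t + (t + y).
    rewrite opprB [x - t + _]addrACA -opprD -mulr2n (mulrnDr t 2 2) addrA subrK.
    by rewrite [t + y]addrC [RHS]addrACA.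
  exact: zmod_id.
Qed.

Section JordanLeftDerivation.
Variable phi : 'B(H) -> 'B(H).
Hypothesis phi_lin : forall (a : K) x y, Alg Lat x -> Alg Lat y ->
  phi (a *: x + y) = a *: phi x + phi y.
Variable C : K.
Hypothesis C_ge0 : 0 <= C.
Hypothesis phi_bounded : forall x, Alg Lat x -> `|phi x| <= C * `|x|.
Hypothesis phi_sqr : forall x, Alg Lat x -> phi (x * x) = (x * phi x) *+ 2.

Let jordan0 : phi 0 = 0 := linear_on0 _ _ (Alg_subspace hLat) phi_lin.
Let jordanD := linear_onD _ _ phi_lin.
Let jordanN := linear_onN _ _ (Alg_subspace hLat) phi_lin.

Lemma jordanMn x n : Alg Lat x -> phi (x *+ n) = phi x *+ n.
Proof.
move=> Ax; rewrite -scaler_nat (linear_onZ _ _ (Alg_subspace hLat) phi_lin)//.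
by rewrite scaler_nat.
Qed.

Lemma jordan_polar x y : Alg Lat x -> Alg Lat y ->
  phi (x * y + y * x) = (x * phi y + y * phi x) *+ 2.
Proof.
move=> Ax Ay; apply: (addrI (phi (x * x + y * y))).
have sqD (u v u' v' : 'B(H)) :
    (u + v) * (u' + v') = u * u' + v * v' + (u * v' + v * u').
  by rewrite mulrDl !mulrDr [v * u' + _]addrC addrACA.
rewrite -jordanD; [rewrite -sqD phi_sqr|alg..]; [|alg].
rewrite (jordanD x y)// (jordanD (x * x)); [|alg..].
by rewrite !phi_sqr// sqD !mulrnDl.
Qed.

(** Multiplying [phi e = 2 e phi e] by [e] on the left gives [e phi e = 2 e phi e], so both sides
    vanish. *)
Lemma jordan_idem e : Alg Lat e -> e * e = e -> phi e = 0.
Proof.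
move=> Ae ee; have e2 := phi_sqr e Ae; rewrite ee in e2.
suff e0 : e * phi e = 0 by rewrite e2 e0 mul0rn.
have := congr1 ( *%R e) e2; rewrite mulrnAr mulrA ee mulr2n => /eqP.
by rewrite -subr_eq0 opprD addrA subrr sub0r oppr_eq0 => /eqP.
Qed.

Lemma jordan1 : phi 1 = 0.
Proof. by apply: jordan_idem; [exact: Alg1|rewrite mulr1]. Qed.

(** Polarizing with the idempotent [e] gives [phi x = 2 e phi x], to which the argument of
    [jordan_idem] applies. The lemma covers operators of the corner [e y (1 - e)]. *)
Lemma jordan_corner e x : Alg Lat e -> Alg Lat x -> e * e = e ->
  e * x = x -> x * e = 0 -> phi x = 0.
Proof.
move=> Ae Ax ee ex xe; have phie := jordan_idem e Ae ee.
have := jordan_polar e x Ae Ax; rewrite ex xe addr0 phie mulr0 addr0 => px.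
suff e0 : e * phi x = 0 by rewrite px e0 mul0rn.
have := congr1 ( *%R e) px; rewrite mulrnAr mulrA ee mulr2n => /eqP.
by rewrite -subr_eq0 opprD addrA subrr sub0r oppr_eq0 => /eqP.
Qed.

(** The images under [phi] of the doubled pair are twice the rotation by [c, s] of the pair
    [phi c, phi s], so each doubling gains exactly a factor 4. The right-hand side holds for every
    rotation pair because its entries have norm at most 1. *)
Lemma jordan_rotation_iter n c s (v : H) : rotation_pair c s ->
  (4 ^ n)%:R * (`|phi c v| ^+ 2 + `|phi s v| ^+ 2) <= 2 * (C * `|v|) ^+ 2.
Proof.
elim: n c s => [|n IHn] c s cs; last first.
  have := IHn _ _ (rotation_double c s cs).
  have [[Ac As] [csym ssym] csc cs1] := cs.
  rewrite expnSr natrM -mulrA; apply: le_trans.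
  rewrite ler_wpM2l ?ler0n// (jordan_polar _ _ Ac As).
  rewrite (jordanD (c * c)); [|alg..]; rewrite jordanN; [|alg].
  rewrite !phi_sqr// -mulrnBl.
  have norm2 (x : 'B(H)) : `|(x *+ 2) v| ^+ 2 = 4 * `|x v| ^+ 2.
    by rewrite -scaler_nat operatorZ normrZ exprMn normr_nat -natrX.
  rewrite !norm2 -mulrDr ler_wpM2l ?ler0n// operatorB operatorD !operatorM.
  by rewrite rotation_norm.
have [[Ac As] _ _ _] := cs; have [c1 s1] := rotation_norm_le1 c s cs.
have bound x : Alg Lat x -> `|x| <= 1 -> `|phi x v| ^+ 2 <= (C * `|v|) ^+ 2.
  move=> Ax x1.
  rewrite ler_pXn2r ?nnegrE ?mulr_ge0//.
  rewrite (le_trans (operator_norm_le _ _))// ler_wpM2r//.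
  rewrite (le_trans (phi_bounded _ Ax))//.
  by rewrite -[leRHS]mulr1 ler_wpM2l.
by rewrite mul1r [leRHS]mulr_natl mulr2n lerD// bound.
Qed.

Lemma jordan_rotation c s : rotation_pair c s -> phi c = 0 /\ phi s = 0.
Proof.
move=> cs; have E v : `|phi c v| ^+ 2 + `|phi s v| ^+ 2 = 0.
  apply: (@scalar_archimedean _ _ _ (2 * (C * `|v|) ^+ 2)).
    by rewrite addr_ge0// exprn_ge0.
  move=> n; apply: le_trans (jordan_rotation_iter n _ _ v cs).
  rewrite ler_wpM2r ?addr_ge0 ?exprn_ge0// ler_nat ltnW//.
  exact: ltn_expl.
by split; apply: bounded_operator_ext => v; apply/eqP; move: (E v) => /eqP;
  rewrite paddr_eq0 ?exprn_ge0// !sqrf_eq0 !normr_eq0 => /andP[].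
Qed.

Lemma jordan_symmetric w : Alg Lat w -> symmetric_operator w -> phi w = 0.
Proof.
move=> Aw wsym; pose T := 1 + w * w.
have AT : Alg Lat T by rewrite /T; alg.
have Tw : T * w = w * T by rewrite /T mulrDl mulrDr mul1r mulr1 mulrA.
have Tsym : symmetric_operator T by apply: symmetricD => //; exact: symmetricM.
have [||S AS [TS ST]] := coercive_inverse Lat T 1 (lattice_closed hLat) _ AT ltr01 _.
- by have [[]] := hLat.
- move=> v; rewrite mul1r operatorD operator1 operatorM innerDl (wsym (w v)).
  by rewrite -!normr_inner [leRHS]ger0_norm ?addr_ge0 ?exprn_ge0// lerDl exprn_ge0.
have Sw : S * w = w * S.
  have -> : S * w = S * (w * T) * S by rewrite -!mulrA TS mulr1.
  by rewrite -Tw mulrA ST mul1r.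
have Ssym : symmetric_operator S.
  move=> u v; have TSv (x : H) : T (S x) = x by rewrite -operatorM TS.
  by rewrite -[v in LHS]TSv -Tsym TSv.
have ASw : Alg Lat (w * S) by alg.
(* (1 - w^2) / (1 + w^2) and 2 w / (1 + w^2) *)
have rot : rotation_pair (S *+ 2 - 1) ((w * S) *+ 2).
  have wSw : w * S * (w * S) = S - S * S.
    rewrite mulrA -[w * S * w]mulrA Sw (mulrA w w S).
    have -> : w * w = T - 1 by rewrite /T addrC addKr.
    by rewrite mulrBl TS mul1r mulrBl mul1r.
  split.
  - by split; alg.
  - have Sym2 (x : 'B(H)) : symmetric_operator x -> symmetric_operator (x *+ 2).
      by rewrite mulr2n => xs; exact: symmetricD.
    split; last exact/Sym2/symmetricM.
    by apply: symmetricD; [exact: Sym2|exact: symmetricN].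
  - rewrite mulrBl mulrBr mul1r mulr1 !mulrnAl !mulrnAr -[in RHS]Sw -mulrA.
    by rewrite [S * (w * S)]mulrA Sw.
  rewrite !mulrnAl !mulrnAr wSw mulrBl mulrBr mul1r mulr1 !mulrnAl !mulrnAr.
  have zmod_id (u v t : 'B(H)) : u - v - (v - t) + (v *+ 2 - u) = t.
    rewrite opprB [u - v + _]addrACA -opprD mulr2n addrA subrK.
    by rewrite addrAC subrr add0r.
  by rewrite !mulrnBl zmod_id.
have [phic phis] := jordan_rotation _ _ rot.
have phiS : phi S = 0.
  apply: operator_double_eq0; move: phic.
  by rewrite jordanD ?jordanN ?jordan1 ?oppr0 ?addr0 ?jordanMn//; alg.
have phiwS : phi (w * S) = 0.
  by apply: operator_double_eq0; rewrite -jordanMn.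
(* Polarizing [T S = S T = 1] gives [S phi T = 0], and [S] cancels. Then [T (w S) + (w S) T = 2 w]
   yields [phi w = 0]. *)
have phiT : phi T = 0.
  have := jordan_polar T S AT AS; rewrite TS ST phiS mulr0 add0r.
  rewrite -mulr2n jordanMn ?jordan1 ?mul0rn; last exact: Alg1.
  move/esym/operator_double_eq0 => /(congr1 ( *%R T)).
  by rewrite mulrA TS mul1r mulr0.
apply: operator_double_eq0; rewrite -jordanMn//.
have := jordan_polar T (w * S) AT ASw.
rewrite mulrA Tw -mulrA TS mulr1 -mulrA ST mulr1 -mulr2n => ->.
by rewrite phiT phiwS !mulr0 addr0 mul0rn.
Qed.

(** Twice [d] is the skew operator [q = d - d'] plus the symmetric operator [d + d']. Over the reals
    [q] is no scalar multiple of a symmetric operator, so it needs the separate argument through its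
    kernel. *)
Lemma jordan_commutant d : lattice_commutant Lat d -> phi d = 0.
Proof.
move=> dC; have [d' dd'] := exists_adjoint d.
have d'd v w : << d' v, w >> = << v, d w >>.
  by rewrite inner_conj -dd' -inner_conj.
have d'C : lattice_commutant Lat d'.
  move=> M LM; have clM := lattice_closed hLat _ LM.
  apply: bounded_operator_ext => v; apply/eqP; rewrite -subr_eq0.
  apply/eqP/normr_inner_eq0; set u := (_ - _); rewrite {1}/u innerBl.
  rewrite !operatorM orthogonal_projection_sym// !d'd orthogonal_projection_sym//.
  by rewrite -!operatorM dC// subrr.
pose q := d - d'.
have Ad := commutant_Alg hLat _ dC; have Ad' := commutant_Alg hLat _ d'C.
have Aq : Alg Lat q by rewrite /q; alg.
have qskew v w : << q v, w >> = - << v, q w >>.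
  by rewrite !operatorB innerBl innerBr dd' d'd opprB.
have qphiq : q * phi q = 0.
  apply: operator_double_eq0; rewrite -phi_sqr//; apply: jordan_symmetric; first by alg.
  by move=> v w; rewrite !operatorM !qskew opprK.
pose p := proj [set v | q v = 0].
have clp := closed_subspace_ker q.
have pC : lattice_commutant Lat p.
  apply: (invariant_proj_commutant hLat) => // M v LM qv.
  have qM : proj M * q = q * proj M.
    by rewrite mulrBl mulrBr dC// d'C.
  by rewrite -[_ _]/(q (proj M v) = 0) -operatorM -qM operatorM qv linear0.
have Ap := commutant_Alg hLat _ pC.
have qp : q * p = 0.
  apply: bounded_operator_ext => v.
  by have [] := orthogonal_projectionP _ v clp.
have pq : p * q = 0.
  apply: bounded_operator_ext => v; apply/normr_inner_eq0.
  rewrite {1}operatorM orthogonal_projection_sym// qskew -operatorM.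
  by rewrite qp inner0r oppr0.
(* Since [q phi q = 0], the range of [phi q] lies in the kernel of [q]. *)
have ppq : p * phi q = phi q.
  apply: bounded_operator_ext => v; rewrite operatorM.
  apply: orthogonal_projection_id => //.
  by rewrite -[_ _]/(q (phi q v) = 0) -operatorM qphiq.
have phip : phi p = 0.
  by apply: jordan_idem => //; exact: orthogonal_projection_idem.
have phiq : phi q = 0.
  apply: operator_double_eq0; have := jordan_polar p q Ap Aq.
  by rewrite pq qp addr0 jordan0 phip mulr0 addr0 ppq.
apply: operator_double_eq0; rewrite -jordanMn//.
have -> : d *+ 2 = q + (d + d') by rewrite /q addrCA addrNK mulr2n.
rewrite jordanD//; last by alg.
rewrite phiq add0r; apply: jordan_symmetric; first by alg.
by move=> v w; rewrite !operatorD innerDl innerDr dd' d'd addrC.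
Qed.

Theorem jordan_left_derivation_eq0 z : Alg Lat z -> phi z = 0.
Proof.
move=> Az.
pose D := [set My : set H * 'B(H) | Lat My.1 /\ Alg Lat My.2].
pose off (My : set H * 'B(H)) := proj My.1 * My.2 * (1 - proj My.1).
pose N := \bigcap_(My in D) [set v | off My v = 0].
have clN : closed_subspace N.
  by apply: closed_subspace_bigcap => My _; exact: closed_subspace_ker.
have idem M : Lat M -> proj M * proj M = proj M.
  by move=> /(lattice_closed hLat); exact: orthogonal_projection_idem.
have lower M y : Lat M -> Alg Lat y -> (1 - proj M) * y * proj M = 0.
  by move=> LM Ay; rewrite mulrBl mul1r mulrBl (Alg_projE hLat)// subrr.
have AlgC M : Lat M -> Alg Lat (1 - proj M).
  move=> LM; apply: (AlgD hLat); first exact: Alg1.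
  by apply: (AlgN hLat); exact: (Alg_proj hLat).
have Aoff My : D My -> Alg Lat (off My).
  move=> [LM Ay]; apply: AlgM; last exact: AlgC.
  by apply: AlgM => //; exact: (Alg_proj hLat).
(* Both [y o] and [o y] lie in the same corner as [o], so [phi] kills all three and polarization
   leaves [2 o phi y = 0]. *)
have killN y : Alg Lat y -> forall My, D My -> off My * phi y = 0.
  move=> Ay [M x] [/= LM Ax]; set o := off _; pose e := proj M.
  have Ae : Alg Lat e by exact: (Alg_proj hLat).
  have Ao : Alg Lat o by exact: Aoff.
  have ee : e * e = e by exact: idem.
  have eo : e * o = o by rewrite /o /off /= !mulrA ee.
  have oe : o * e = 0 by rewrite /o /off /= -mulrA mulrBl mul1r ee subrr mulr0.
  have of_ : o * (1 - e) = o by rewrite mulrBr mulr1 oe subr0.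
  have phio : phi o = 0 by exact: (jordan_corner e).
  have eye : e * y * e = y * e by exact: (Alg_projE hLat).
  have fye : (1 - e) * (y * e) = 0 by rewrite mulrA; exact: lower.
  clearbody o e; have := jordan_polar y o Ay Ao; rewrite phio mulr0 add0r => yo.
  apply: operator_double_eq0; rewrite -yo jordanD ?(jordan_corner e) ?addr0//.
  all: try by alg.
  - by rewrite mulrA eo.
  - by rewrite -of_ -2!mulrA fye mulr0.
  - by rewrite -[in LHS]eo !mulrA eye -mulrA eo.
  - by rewrite -mulrA oe mulr0.
have N_Alg y v : Alg Lat y -> N v -> N (y v).
  move=> Ay Nv [M x] [LM Ax]; rewrite -[_ _]/(off (M, x) (y v) = 0).
  have Nv0 My : D My -> off My v = 0 by exact: Nv.
  (* With [f = 1 - e], lattice invariance gives [f y = f y f], hence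
     [e x f y = e x y f - e x (e y f)]. *)
  have -> : off (M, x) (y v) = (off (M, x * y) - proj M * x * off (M, y)) v.
    rewrite -operatorM; congr (bounded_operator_fun _ v); rewrite /off /=.
    set e := proj M; set f := 1 - e.
    have fyf : f * y = f * y * f by rewrite [RHS]mulrBr mulr1 lower// subr0.
    rewrite -mulrA fyf !mulrA -!mulrBl; congr (_ * f).
    by rewrite [_ * f]mulrBr mulr1.
  have AM : Alg Lat (x * y) by exact: AlgM.
  rewrite operatorB operatorM (Nv0 (M, x * y))// (Nv0 (M, y))//.
  by rewrite (linear0 (proj M * x)) subr0.
pose p := proj N.
have pC : lattice_commutant Lat p.
  apply: (invariant_proj_commutant hLat) => // M v LM; apply: N_Alg.
  exact: (Alg_proj hLat).
have Ap := commutant_Alg hLat _ pC.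
have pp : p * p = p by exact: orthogonal_projection_idem.
have pN v : N (p v) by have [] := orthogonal_projectionP _ v clN.
have pzp : p * (z * p) = z * p.
  apply: bounded_operator_ext => v; rewrite operatorM.
  by apply: orthogonal_projection_id => //; exact: (N_Alg z (p v)).
have pphi : p * phi z = phi z.
  apply: bounded_operator_ext => v; rewrite operatorM.
  apply: orthogonal_projection_id => // My DMy.
  by rewrite -[_ _]/((off My * phi z) v = 0) killN.
have zpC : lattice_commutant Lat (z * p).
  move=> M LM; have : off (M, z) * p = 0.
    by apply: bounded_operator_ext => v; exact: (pN v (M, z)).
  rewrite /off /= mulrBr mulr1 (Alg_projE hLat)// mulrBl => /eqP.
  by rewrite subr_eq0 -!mulrA pC// => /eqP.
have phizp : phi (z * p) = 0 by exact: jordan_commutant.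
have phip : phi p = 0 by exact: jordan_commutant.
apply: operator_double_eq0.
have := jordan_polar p z Ap Az; rewrite phip mulr0 addr0 pphi => <-.
(* Because [z p = p z p], this difference is [p z (1 - p)], an operator of the corner of [p]; the
   rest of [p z + z p] is twice an element of the commutant. *)
have phid : phi (p * z - z * p) = 0.
  apply: (jordan_corner p) => //; first by alg.
    by rewrite mulrBr mulrA pp pzp.
  by rewrite mulrBl -!mulrA pp pzp subrr.
have -> : p * z + z * p = (p * z - z * p) + (z * p) *+ 2.
  by rewrite mulr2n addrA subrK.
by rewrite jordanD ?jordanMn ?phid ?phizp ?mul0rn ?addr0//; alg.
Qed.

End JordanLeftDerivation.

End JordanLeftDerivations.

(** * Maps satisfying the condition at the projection onto a lattice member *)

Section DerivableAtProjection.
Context {R : realType} {k : scalar_kind} {H : hilbertSpace R k}.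
Local Notation K := (scalars R k).
Local Notation "<< x , y >>" := (inner H x y).
Context {Lat : set (set H)} (hLat : commutative_subspace_lattice Lat).
Local Notation proj := orthogonal_projection.
Implicit Types (x y z A B : 'B(H)).

Lemma operator_normM A B : `|A * B| <= `|A| * `|B|.
Proof.
apply: operator_norm_le_bound => [|v].
  by rewrite mulr_ge0 ?operator_normE ?operator_norm_ge0.
rewrite operatorM (le_trans (operator_norm_le _ _))// -mulrA ler_wpM2l//.
  exact: operator_norm_ge0.
exact: operator_norm_le.
Qed.

(** Coercive with constant 1: the scalar part contributes at least [(|x| + 1) |v|^2] and [x] takes
    away at most [|x| |v|^2]. It makes every member of the algebra an invertible one minus a
    scalar. *)
Lemma Alg_shift_inverse x (a : K) : Alg Lat x -> `|x| + 1 <= a ->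
  exists2 y, Alg Lat y &
    (x + a *: (1 : 'B(H))) * y = 1 /\ y * (x + a *: (1 : 'B(H))) = 1.
Proof.
move=> Ax xa; have a0 : 0 <= a.
  by apply: le_trans xa; rewrite addr_ge0 ?operator_normE ?operator_norm_ge0.
apply: (coercive_inverse Lat _ 1 (lattice_closed hLat) _ _ ltr01) => [||v].
- by have [[]] := hLat.
- by alg.
rewrite mul1r operatorD operatorZ operator1 innerDl innerZl -normr_inner.
have xv : `|<< x v, v >>| <= `|x| * `|v| ^+ 2.
  rewrite (le_trans (cauchy_schwarz _ _))// mulrA ler_wpM2r//.
  exact: operator_norm_le.
have av : (`|x| + 1) * `|v| ^+ 2 <= `|a * `|v| ^+ 2|.
  by rewrite ger0_norm ?mulr_ge0 ?exprn_ge0// ler_wpM2r ?exprn_ge0.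
rewrite addrC (le_trans _ (lerB_normD _ _))//.
by rewrite lerBrDr (le_trans _ av)// mulrDl mul1r addrC lerD2r.
Qed.

(* Hua's identity: if x and y = 1 - x have inverses u and v, then u + v = u v. *)
Lemma jordan_of_inverse (phi : 'B(H) -> 'B(H)) :
  (forall (a : K) x y, Alg Lat x -> Alg Lat y ->
    phi (a *: x + y) = a *: phi x + phi y) ->
  phi 1 = 0 ->
  (forall x u, Alg Lat x -> Alg Lat u -> x * u = 1 -> u * x = 1 ->
    x * phi u + u * phi x = 0) ->
  forall x, Alg Lat x -> phi (x * x) = (x * phi x) *+ 2.
Proof.
move=> phi_lin phi1 phiV.
have A0 := Alg0 hLat; have A1 := @Alg1 _ _ _ Lat.
have phiD := linear_onD _ _ phi_lin.
have phiZ := linear_onZ _ _ (Alg_subspace hLat) phi_lin.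
have phiN := linear_onN _ _ (Alg_subspace hLat) phi_lin.
have sqr_inv x u v : Alg Lat x -> Alg Lat u -> Alg Lat v ->
    x * u = 1 -> u * x = 1 -> (1 - x) * v = 1 -> v * (1 - x) = 1 ->
    phi (x * x) = (x * phi x) *+ 2.
  move=> Ax Au Av xu ux; set y := 1 - x => yv vy.
  have Ay : Alg Lat y by rewrite /y; alg.
  have phiy : phi y = - phi x by rewrite /y phiD ?phiN ?phi1 ?add0r//; alg.
  have xy : x * y = y * x by rewrite /y mulrBr mulrBl mulr1 mul1r.
  have uy : u * y = y * u by rewrite /y mulrBr mulrBl mulr1 mul1r ux xu.
  have xvE : x * v = v * x.
    have -> : x = 1 - y by rewrite /y opprB addrC subrK.
    by rewrite mulrBl mulrBr mul1r mulr1 yv vy.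
  have uvE : u + v = u * v.
    have -> : u + v = u * (y + x) * v by rewrite mulrDr mulrDl -mulrA yv mulr1 ux mul1r.
    by rewrite /y subrK mulr1.
  have vuE : v * u = u * v.
    have -> : v * u = v * (y + x) * u by rewrite /y subrK mulr1.
    by rewrite mulrDr mulrDl vy mul1r -mulrA xu mulr1 uvE.
  have xyuv : x * y * (u * v) = 1 by rewrite -mulrA (mulrA y) -uy -mulrA yv mulr1 xu.
  have uvxy : u * v * (x * y) = 1 by rewrite xy -mulrA (mulrA v) vy mul1r ux.
  (* The inverse rule for the pairs [x, u] and [y, v] gives [phi u = - u^2 phi x] and
     [phi v = v^2 phi x], the sign changing since [phi y = - phi x]. *)
  have phiu : phi u = - (u * (u * phi x)).
    apply/eqP; rewrite -addr_eq0 -[phi u]mul1r -{1}ux -mulrA -mulrDr.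
    by rewrite phiV ?mulr0.
  have phiv : phi v = v * (v * phi x).
    apply/eqP; rewrite -subr_eq0 -mulrN -mulrN -phiy -[phi v]mul1r -{1}vy -mulrA.
    by rewrite -mulrDr phiV ?mulr0.
  (* Multiplied by [x y] and with [u v = u + v], the rule for the pair [x y, u v] becomes
     [(x^2 - y^2) phi x + phi (x - x^2) = 0], where [x^2 - y^2 = x - y]. *)
  have := phiV (x * y) (u * v) (AlgM _ _ Ax Ay) (AlgM _ _ Au Av) xyuv uvxy.
  move/(congr1 ( *%R (x * y))); rewrite mulr0 mulrDr (mulrA (x * y) (u * v)) xyuv mul1r.
  rewrite -uvE phiD// phiu phiv.
  have xyu w : x * y * (u * w) = y * w by rewrite mulrA -(mulrA x) -uy mulrA xu mul1r.
  have xyv w : x * y * (v * w) = x * w by rewrite mulrA -(mulrA x) yv mulr1.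
  rewrite [x * y * (- _ + _)]mulrDr mulrN xyu xyv (mulrA y) -uy (mulrA x v) xvE.
  rewrite -(mulrA u) -(mulrA v) mulrDr mulrN xyu xyv.
  have xDy : x + y = 1 by rewrite /y addrC subrK.
  have yphi : y * phi x = phi x - x * phi x by rewrite /y mulrBl mul1r.
  have xyE : x * y = x - x * x by rewrite /y mulrBr mulr1.
  clearbody y.
  have -> : - (y * (y * phi x)) + x * (x * phi x) = x * phi x - y * phi x.
    have sqE : x * x - y * y = x - y.
      have -> : x - y = (x - y) * (x + y) by rewrite xDy mulr1.
      by rewrite mulrDr !mulrBl xy addrA subrK.
    by rewrite addrC !mulrA -!mulrBl sqE.
  rewrite yphi xyE phiD ?phiN//; [|by alg|by alg].
  rewrite opprB !addrA subrK -mulr2n => /eqP.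
  by rewrite subr_eq0 => /eqP ->.
(* With [a = |x| + 2] both [x + a] and [1 - (x + a) = - (x + |x| + 1)] are invertible. The shift is
   undone at the end, as [phi] vanishes on scalars. *)
move=> x Ax; pose a : K := `|x| + 1 + 1.
have [u Au [xu ux]] : exists2 y, Alg Lat y &
    (x + a *: (1 : 'B(H))) * y = 1 /\ y * (x + a *: (1 : 'B(H))) = 1.
  by apply: Alg_shift_inverse => //; rewrite lerDl.
have [v Av [xv vx]] := Alg_shift_inverse x (`|x| + 1) Ax (lexx _).
have xE : 1 - (x + a *: (1 : 'B(H))) = - (x + (`|x| + 1) *: (1 : 'B(H))).
  by rewrite [a *: _]scalerDl scale1r addrA [- (_ + 1)]opprD [1 + _]addrC subrK.
have Axa : Alg Lat (x + a *: (1 : 'B(H))) by alg.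
have := sqr_inv _ u (- v) Axa Au (AlgN hLat _ Av).
rewrite xE mulrNN mulrNN => /(_ xu ux xv vx).
set b := a *: (1 : 'B(H)).
have Ab : Alg Lat b by rewrite /b; alg.
have phib : phi b = 0 by rewrite /b phiZ// phi1 scaler0.
have bE z : b * z = a *: z by rewrite /b -bounded_operator_scaleAl mul1r.
have bC : x * b = a *: x by rewrite /b -bounded_operator_scaleAr mulr1.
clearbody b; rewrite (phiD x b)// phib addr0 mulrDl !mulrDr !bE bC.
have Aab := AlgZ hLat a _ Ab; have Aax := AlgZ hLat a _ Ax.
have Axx := AlgM _ _ Ax Ax.
rewrite (phiD (x * x + _))//; try by alg.
rewrite (phiD (x * x))// (phiD (a *: x))// !phiZ// phib scaler0 addr0.
by rewrite -addrA -mulr2n mulrDl bE mulrnDl => /addIr.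
Qed.

(** The right-hand side [P *+ 2] absorbs the factors 2 of the original condition when [B] is halved.
    The conclusions control [delta] on [A P], [P A Q] and [Q A Q], which together make up [A]. *)
Lemma jordan_at_projection (L : set H) (delta : 'B(H) -> 'B(H)) (P Q : 'B(H)) :
  Lat L -> P = proj L -> Q = 1 - P -> continuous_linear_on (Alg Lat) delta ->
  (forall A B, Alg Lat A -> Alg Lat B ->
     A * B + B * A = P *+ 2 -> A * delta B + B * delta A = delta P) ->
  [/\ delta P = 0,
      forall x, Alg Lat x -> delta (x * P) = 0,
      forall x, Alg Lat x -> P * delta (Q * x * Q) = 0,
      forall x y, Alg Lat x -> Alg Lat y ->
        Q * x * Q * (Q * y * Q) + Q * y * Q * (Q * x * Q) = 0 ->
        Q * x * Q * delta (Q * y * Q) + Q * y * Q * delta (Q * x * Q) = 0 &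
      forall x y, Alg Lat x -> Alg Lat y ->
        Q * delta (P * x * Q) = 0 /\
        delta (P * x * Q * (Q * y * Q)) = P * x * Q * delta (Q * y * Q)].
Proof.
move=> LL PE QE [delta_Alg delta_lin delta_cont] deltaP.
have A0 := Alg0 hLat; have A1 := @Alg1 _ _ _ Lat.
have AP : Alg Lat P by rewrite PE; exact: Alg_proj.
have AQ : Alg Lat Q by rewrite QE; alg.
have PP : P * P = P.
  by rewrite PE; apply: orthogonal_projection_idem; exact: (lattice_closed hLat).
have PQ : P * Q = 0 by rewrite QE mulrBr mulr1 PP subrr.
have QP : Q * P = 0 by rewrite QE mulrBl mul1r PP subrr.
have QQ : Q * Q = Q by rewrite {1}QE mulrBl mul1r PQ subr0.
have PxP x : Alg Lat x -> P * (x * P) = x * P.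
  by move=> Ax; rewrite mulrA PE; exact: (Alg_projE hLat).
have PDQ : P + Q = 1 by rewrite QE addrC subrK.
have deltaD := linear_onD _ _ delta_lin.
have deltaN := linear_onN _ _ (Alg_subspace hLat) delta_lin.
have dP0 : delta P = 0.
  have := deltaP P P AP AP; rewrite PP -mulr2n => /(_ erefl) dP.
  have PdP : P * delta P = 0.
    have := congr1 ( *%R P) dP; rewrite mulrDr mulrA PP -[RHS]addr0.
    by move/addrI.
  by rewrite -dP PdP addr0.
have {}deltaP A B : Alg Lat A -> Alg Lat B ->
    A * B + B * A = P *+ 2 -> A * delta B + B * delta A = 0.
  by move=> AA AB ABP; rewrite deltaP.
have inv z u c : Alg Lat z -> Alg Lat u -> Alg Lat c ->
    z * u = 1 -> u * z = 1 -> c * P = 0 -> P * c = 0 ->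
    (z * P + c) * delta (u * P) + u * P * delta (z * P + c) = 0.
  move=> Az Au Ac zu uz cP Pc.
  apply: deltaP; [by alg|by alg|].
  rewrite mulrDl mulrDr -!mulrA PxP// PxP// Pc mulr0 addr0.
  by rewrite !mulrA zu uz mul1r -(mulrA c) -(PxP u)// mulrA cP mul0r addr0.
have inv0 z u : Alg Lat z -> Alg Lat u -> z * u = 1 -> u * z = 1 ->
    z * P * delta (u * P) + u * P * delta (z * P) = 0.
  move=> Az Au zu uz; have := inv z u 0 Az Au A0 zu uz (mul0r _) (mulr0 _).
  by rewrite !addr0.
have invc z u c : Alg Lat z -> Alg Lat u -> Alg Lat c ->
    z * u = 1 -> u * z = 1 -> c * P = 0 -> P * c = 0 ->
    c * delta (u * P) + u * P * delta c = 0.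
  move=> Az Au Ac zu uz cP Pc; have := inv z u c Az Au Ac zu uz cP Pc.
  rewrite deltaD//; last by alg.
  by rewrite mulrDl mulrDr addrACA inv0// add0r.
have Pdc c : Alg Lat c -> c * P = 0 -> P * c = 0 -> P * delta c = 0.
  move=> Ac cP Pc; have := invc 1 1 c A1 A1 Ac (mulr1 _) (mulr1 _) cP Pc.
  by rewrite !mul1r dP0 mulr0 add0r.
have QduP z u : Alg Lat z -> Alg Lat u -> z * u = 1 -> u * z = 1 ->
    Q * delta (u * P) = 0.
  move=> Az Au zu uz; have := invc z u Q Az Au AQ zu uz QP PQ.
  by rewrite -mulrA (Pdc Q)// mulr0 addr0.
(* Extends [QduP] from invertible elements: [x + b] is invertible, and the scalar [b] contributes a
   multiple of [delta P = 0]. *)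
have QdxP x : Alg Lat x -> Q * delta (x * P) = 0.
  move=> Ax; pose b := (`|x| + 1) *: (1 : 'B(H)).
  have Ab : Alg Lat b by rewrite /b; alg.
  have [u Au [xu ux]] := Alg_shift_inverse x (`|x| + 1) Ax (lexx _).
  have := QduP u (x + b) Au (AlgD hLat _ _ Ax Ab) ux xu.
  rewrite mulrDl deltaD; [|by alg|by alg].
  have -> : delta (b * P) = 0.
    rewrite /b -bounded_operator_scaleAl mul1r.
    by rewrite (linear_onZ _ _ (Alg_subspace hLat) delta_lin)// dP0 scaler0.
  by rewrite addr0.
(* By [QdxP], left multiplication by [P] fixes [delta (y * P)]. So [inv0] is the inverse rule for
   the map sending [y] to [delta (y * P)], which is therefore a bounded Jordan left derivation. *)
have dxP x : Alg Lat x -> delta (x * P) = 0.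
  move=> Ax.
  have PdxP y : Alg Lat y -> P * delta (y * P) = delta (y * P).
    by move=> Ay; rewrite -[RHS]mul1r -PDQ mulrDl QdxP// addr0.
  have [C C0 deltaC] :=
    continuous_on_bounded _ _ (Alg_subspace hLat) delta_lin delta_cont.
  apply: (jordan_left_derivation_eq0 hLat (fun y => delta (y * P)) _ (C * `|P|)) => //.
  - move=> a y z Ay Az; rewrite mulrDl -bounded_operator_scaleAl delta_lin//; alg.
  - by rewrite mulr_ge0// operator_normE operator_norm_ge0.
  - move=> y Ay; rewrite (le_trans (deltaC _ _))//; first by alg.
    by rewrite mulrAC -mulrA ler_wpM2l// operator_normM.
  - apply: jordan_of_inverse => [a y z Ay Az| |y u Ay Au yu uy].
    + by rewrite mulrDl -bounded_operator_scaleAl delta_lin//; alg.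
    + by rewrite mul1r.
    by rewrite -PdxP// -[delta (y * P)]PdxP// !mulrA inv0.
have PdQ x : Alg Lat x -> P * delta (Q * x * Q) = 0.
  by move=> Ax; apply: Pdc; [alg|rewrite -!mulrA QP !mulr0|rewrite !mulrA PQ !mul0r].
split=> // x y Ax Ay.
  set c := Q * x * Q; set d := Q * y * Q => cd.
  have Ac : Alg Lat c by rewrite /c; alg.
  have Ad : Alg Lat d by rewrite /d; alg.
  have cP : c * P = 0 by rewrite /c -mulrA QP mulr0.
  have Pc : P * c = 0 by rewrite /c !mulrA PQ !mul0r.
  have dP : d * P = 0 by rewrite /d -mulrA QP mulr0.
  have Pd : P * d = 0 by rewrite /d !mulrA PQ !mul0r.
  have Pdc0 : P * delta c = 0 by exact: PdQ.
  have Pdd0 : P * delta d = 0 by exact: PdQ.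
  clearbody c d.
  (* For [A = P + c] and [B = P + d] the mixed products vanish, leaving
     [A B + B A = 2 P + (c d + d c)]. *)
  have := deltaP _ _ (AlgD hLat _ _ AP Ac) (AlgD hLat _ _ AP Ad).
  rewrite 2!mulrDl 4!mulrDr PP cP Pc dP Pd !add0r !addr0 addrACA cd addr0 -mulr2n.
  rewrite deltaD// deltaD// dP0 !add0r => /(_ erefl).
  by rewrite !mulrDl Pdc0 Pdd0 !add0r.
have corner m d : Alg Lat m -> Alg Lat d -> m * P = 0 -> P * m = m ->
    d * P = 0 -> P * d = 0 ->
    d * delta m = 0 /\
    (P + m) * (- delta m - delta (m * d) + delta d) + (P - m - m * d) * delta m = 0.
  move=> Am Ad mP Pm dP Pd.
  have Amd : Alg Lat (m * d) by alg.
  have mm : m * m = 0 by rewrite -{2}Pm mulrA mP mul0r.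
  have dm : d * m = 0 by rewrite -Pm mulrA dP mul0r.
  have Qm : Q * m = 0 by rewrite -Pm mulrA QP mul0r.
  have Qd : Q * d = d by rewrite -[RHS]mul1r -PDQ mulrDl Pd add0r.
  (* The two products are [P - m] and [P + m]. Multiplying the resulting identity by [Q] then
     isolates [d delta m]. *)
  have AB : (P + m) * (P - m - m * d + d) + (P - m - m * d + d) * (P + m) = P *+ 2.
    have -> : (P + m) * (P - m - m * d + d) = P - m.
      rewrite mulrDl !mulrDr !mulrN PP Pm Pd mP mm !mulrA Pm mm mul0r.
      by rewrite oppr0 !addr0 add0r subrK.
    have -> : (P - m - m * d + d) * (P + m) = P + m.
      rewrite mulrDr !mulrDl !mulNr PP mP Pm mm dP dm -!mulrA dP dm !mulr0.
      by rewrite oppr0 !addr0.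
    by rewrite addrACA addNr addr0 mulr2n.
  have := deltaP _ _ _ _ AB.
  rewrite (deltaD P m)// dP0 add0r (deltaD _ d); [|by alg|by alg].
  rewrite (deltaD (P - m)); [|by alg|by alg].
  rewrite (deltaD P); [|by alg|by alg].
  rewrite !deltaN// dP0 add0r => E.
  have {}E : (P + m) * (- delta m - delta (m * d) + delta d)
      + (P - m - m * d + d) * delta m = 0 by apply: E; alg.
  have ddm : d * delta m = 0.
    have := congr1 ( *%R Q) E; rewrite mulr0 mulrDr !mulrA.
    have -> : Q * (P + m) = 0 by rewrite mulrDr QP Qm addr0.
    have -> : Q * (P - m - m * d + d) = d.
      by rewrite mulrDr !mulrBr QP Qm mulrA Qm mul0r !subr0 add0r.
    by rewrite mul0r add0r.
  by split=> //; move: E; rewrite [X in _ + X]mulrDl ddm addr0.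
pose m := P * x * Q; pose d := Q * y * Q.
have Am : Alg Lat m by rewrite /m; alg.
have Ad : Alg Lat d by rewrite /d; alg.
have mP : m * P = 0 by rewrite /m -mulrA QP mulr0.
have Pm : P * m = m by rewrite /m !mulrA PP.
have dP : d * P = 0 by rewrite /d -mulrA QP mulr0.
have Pd : P * d = 0 by rewrite /d !mulrA PQ !mul0r.
have dQ : d * Q = d by rewrite /d -mulrA QQ.
rewrite -/m -/d; clearbody m d.
have Qdelta z : Alg Lat z -> z * P = 0 -> P * z = z -> Q * delta z = 0.
  by move=> Az zP Pz; have [] := corner z Q Az AQ zP Pz QP PQ.
have Qm := Qdelta m Am mP Pm; split=> //.
have Amd : Alg Lat (m * d) by alg.
have Qmd : Q * delta (m * d) = 0.
  by apply: Qdelta => //; [rewrite -mulrA dP mulr0|rewrite mulrA Pm].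
have mQ : m * Q = m by rewrite -[RHS]mulr1 -PDQ mulrDr mP add0r.
have mz0 z : Q * z = 0 -> m * z = 0 by move=> Qz; rewrite -mQ -mulrA Qz mulr0.
have [ddm E] := corner m d Am Ad mP Pm dP Pd.
have Pdm : P * delta m = delta m by rewrite -[RHS]mul1r -PDQ mulrDl Qm addr0.
have Pdmd : P * delta (m * d) = delta (m * d).
  by rewrite -[RHS]mul1r -PDQ mulrDl Qmd addr0.
have mdm := mz0 _ Qm; have mdmd := mz0 _ Qmd.
(* What survives of [E] is [- delta m - delta (m d) + m delta d + delta m = 0]. *)
move: E; rewrite mulrDl !mulrBl Pdm mdm subr0 -[m * d * _]mulrA ddm mulr0 subr0.
rewrite !mulrDr !mulrN Pdm Pdmd Pdc// mdm mdmd oppr0 !add0r addr0.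
rewrite addrAC [- delta m - _]addrC subrK addrC => /eqP.
by rewrite subr_eq0 => /eqP.
Qed.

End DerivableAtProjection.

Theorem corollary2p6 (R : realType) (k : scalar_kind) (H : hilbertSpace R k)
    (Lat : set (set H)) (hLat : commutative_subspace_lattice Lat)
    (hLat_nontrivial : nontrivial_lattice Lat)
    (L : set H) (hL : Lat L) (hL_nontrivial : nontrivial_subspace L)
    (delta : 'B(H) -> 'B(H)) (hdelta : continuous_linear_on (Alg Lat) delta) :
  let P := orthogonal_projection L in
  let Q := 1 - P in
  (forall A B, Alg Lat A -> Alg Lat B ->
     A * B + B * A = P ->
     2 *: (A * delta B) + 2 *: (B * delta A) = delta P)
  <->
  (exists beta : 'B(H) -> 'B(H),
     [/\ continuous_linear_on (Alg Lat) beta,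
         forall A, Alg Lat A -> delta A = beta A + P * A * Q * delta 1,
         forall A, Alg Lat A -> beta A = Q * beta (Q * A * Q) * Q,
         forall A B, Alg Lat A -> Alg Lat B ->
           Q * A * Q * B * Q + Q * B * Q * A * Q = 0 ->
           Q * A * beta B + Q * B * beta A = 0 &
         forall A B, Alg Lat A -> Alg Lat B ->
           P * A * Q * beta B = P * A * Q * B * Q * delta 1]).

Proof.
move=> P Q.
have A1 := @Alg1 _ _ _ Lat.
have PE : P = orthogonal_projection L by [].
have QE : Q = 1 - P by [].
clearbody Q; clearbody P.
have AP : Alg Lat P by rewrite PE; exact: Alg_proj.
have AQ : Alg Lat Q by rewrite QE; alg.
have PP : P * P = P.
  by rewrite PE; apply: orthogonal_projection_idem; exact: (lattice_closed hLat).
have PQ : P * Q = 0 by rewrite QE mulrBr mulr1 PP subrr.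
have QP : Q * P = 0 by rewrite QE mulrBl mul1r PP subrr.
have QQ : Q * Q = Q by rewrite {1}QE mulrBl mul1r PQ subr0.
have PxP x : Alg Lat x -> P * (x * P) = x * P.
  by move=> Ax; rewrite mulrA PE; exact: (Alg_projE hLat).
have PDQ : P + Q = 1 by rewrite QE addrC subrK.
have QxQ x : Alg Lat x -> Q * x * Q = Q * x.
  move=> Ax; rewrite -[RHS]mulr1 -PDQ mulrDr -(mulrA Q x P) -PxP//.
  by rewrite (mulrA Q P) QP mul0r add0r.
have [delta_Alg delta_lin delta_cont] := hdelta.
have deltaD := linear_onD _ _ delta_lin.
have deltaZ := linear_onZ _ _ (Alg_subspace hLat) delta_lin.
have halfK (x : 'B(H)) : 2^-1 *: (2 *: x) = x.
  by rewrite scalerA mulVf ?pnatr_eq0// scale1r.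
have doubleK (x : 'B(H)) : 2 *: (2^-1 *: x) = x.
  by rewrite scalerA divff ?pnatr_eq0// scale1r.
split=> [deltaP|[beta [beta_cont deltaE betaE betaQ betaPQ]]].
  have [|dP0 dxP PdQ dQQ dcorner] :=
    jordan_at_projection hLat L delta P Q hL PE QE hdelta.
    move=> A B AA AB ABP; have := deltaP A (2^-1 *: B) AA (AlgZ hLat _ _ AB).
    rewrite -bounded_operator_scaleAr -bounded_operator_scaleAl -scalerDr ABP.
    rewrite -(scaler_nat 2 P) halfK => /(_ erefl).
    by rewrite deltaZ// -bounded_operator_scaleAr -bounded_operator_scaleAl !doubleK.
  have dAQ A : Alg Lat A -> Alg Lat (delta A) by exact: delta_Alg.
  have dQ A : Alg Lat A -> Q * delta (Q * A * Q) = delta (Q * A * Q).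
    by move=> AA; rewrite -[RHS]mul1r -PDQ mulrDl PdQ// add0r.
  have d1 : delta 1 = delta Q by rewrite -PDQ deltaD// dP0 add0r.
  (* Since [delta] kills [A P], the part [beta] is its compression to the [Q]-corner, and the extra
     term of the formula comes from [P A Q]. *)
  exists (fun A => delta (Q * A * Q)); split.
  - have [C C0 deltaC] :=
      continuous_on_bounded _ _ (Alg_subspace hLat) delta_lin delta_cont.
    have QlinQ (a : scalars R k) x y : Alg Lat x -> Alg Lat y ->
        delta (Q * (a *: x + y) * Q) = a *: delta (Q * x * Q) + delta (Q * y * Q).
      move=> Ax Ay; rewrite mulrDr mulrDl -bounded_operator_scaleAr.
      by rewrite -bounded_operator_scaleAl delta_lin//; alg.
    split=> [A AA|//|]; first by apply: delta_Alg; alg.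
    apply: (bounded_on_continuous _ _ (Alg_subspace hLat) QlinQ (C * `|Q| * `|Q|)).
      by rewrite !mulr_ge0// operator_normE operator_norm_ge0.
    move=> A AA; rewrite (le_trans (deltaC _ _))//; first by alg.
    rewrite -!mulrA ler_wpM2l// mulrA [leRHS]mulrA [leRHS]mulrAC.
    by rewrite (le_trans (operator_normM _ _))// ler_wpM2r ?operator_normM.
  - move=> A AA.
    (* The factor [Q * 1 * Q] puts [P A Q] in the shape required by [dcorner] with second argument
       1, giving [P A Q delta Q = P A Q delta 1]. *)
    have {1}-> : A = A * P + (P * A * Q * (Q * 1 * Q) + Q * A * Q).
      by rewrite mulr1 QQ -[P * A * Q * Q]mulrA QQ -!mulrDl PDQ mul1r -mulrDr PDQ mulr1.
    rewrite deltaD; [|by alg|by alg]; rewrite deltaD; [|by alg|by alg].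
    by rewrite dxP// add0r (dcorner A 1 AA A1).2 mulr1 QQ d1 addrC.
  - move=> A AA.
    have -> : Q * (Q * A * Q) * Q = Q * A * Q by rewrite -!mulrA QQ !mulrA QQ.
    have AQAQ : Alg Lat (delta (Q * A * Q)) by apply: dAQ; alg.
    by rewrite [RHS]QxQ// dQ.
  - move=> A B AA AB AB0; have := dQQ A B AA AB.
    rewrite !mulrA -[Q * A * Q * Q]mulrA -[Q * B * Q * Q]mulrA QQ => /(_ AB0).
    by rewrite -[Q * A * Q * _]mulrA -[Q * B * Q * _]mulrA !dQ.
  - move=> A B AA AB; rewrite -(dcorner A B AA AB).2.
    (* The operator [P A Q B Q] is factored a second time, as the corner of [A Q B] times [Q], so
       that [dcorner] evaluates [delta] on it in two ways. *)
    have -> : P * A * Q * (Q * B * Q) = P * (A * Q * B) * Q * (Q * 1 * Q).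
      rewrite mulr1 !mulrA -[P * A * Q * Q]mulrA -[_ * Q * Q]mulrA !QQ.
      by rewrite -[RHS]mulrA QQ.
    rewrite (dcorner _ 1 _ A1).2; last by alg.
    by rewrite mulr1 QQ d1 !mulrA.
move=> A B AA AB ABP.
have beta0 : beta 0 = 0.
  by have [_ beta_lin _] := beta_cont; exact: linear_on0 (Alg_subspace hLat) beta_lin.
have Qbeta x : Alg Lat x -> Q * beta x = beta x.
  by move=> Ax; rewrite betaE// !mulrA QQ.
have dP0 : delta P = 0.
  by rewrite deltaE// betaE// QP mul0r beta0 mulr0 mul0r add0r PP PQ mul0r.
(* The first summand depends on [x * y] only, so symmetrizing turns it into [P (A B + B A) Q delta 1
   = P P Q delta 1 = 0]; [betaQ] disposes of the second. *)
have term x y : Alg Lat x -> Alg Lat y ->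
    x * delta y = P * (x * y) * Q * delta 1 + Q * x * beta y.
  move=> Ax Ay; rewrite deltaE// mulrDr.
  have -> : x * beta y = P * x * Q * y * Q * delta 1 + Q * x * beta y.
    by rewrite -betaPQ// -[P * x * Q * _]mulrA Qbeta// -!mulrDl PDQ mul1r.
  have -> : P * (x * y) = P * x * Q * y + x * P * y.
    by rewrite -(PxP x)// (mulrA P x P) -mulrDl -mulrDr (addrC Q) PDQ mulr1 mulrA.
  by rewrite addrAC; congr (_ + _); rewrite !mulrDl !mulrA.
rewrite -scalerDr (term A B)// (term B A)// dP0.
have QABQ : Q * A * Q * B * Q + Q * B * Q * A * Q = 0.
  by rewrite !QxQ// -!mulrA -mulrDr !mulrA -mulrDl ABP PQ mulr0.
by rewrite addrACA betaQ// addr0 -!mulrDl -mulrDr ABP PP PQ mul0r scaler0.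
Qed.
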